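(* Let $f:(0,1)\to\mathbb{R}$ be defined by $f(x)=x$ for $0<x<1/2$, $f(x)=1+3(x-1)/2$ for $1/2\le x<3/5$, and $f(x)=1-x$ for $3/5\le x<1$. Let $G\in\mathcal{G}(n,p)$ for some $p=p(n)$. If $pn=n^{x+o(1)}$ for some $x\in(0,1/2)\cup(1/2,1)$, then with high probability $\chi_c(G)=n^{f(x)+o(1)}$.
   Context: $\mathcal{G}(n,p)$ is the binomial random graph: vertex set $[n]$, each pair of distinct vertices being an edge independently with probability $p$. A clique is a set of pairwise adjacent vertices; it is maximal if it is not a proper subset of another clique. A clique colouring of $G$ is a vertex colouring such that no maximal clique is monochromatic, ignoring isolated vertices (i.e. no maximal clique of size at least 2 is monochromatic). The clique chromatic number $\chi_c(G)$ is the smallest number of colours in a clique colouring of $G$. Asymptotics are as $n\to\infty$; $x$ is a constant; an event holds with high probability if its probability tends to 1. The conclusion means that there is a deterministic function $\delta(n)=o(1)$ such that, with high probability, $n^{f(x)-\delta(n)}\le\chi_c(G)\le n^{f(x)+\delta(n)}$. *)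

(* Defs.v *)
From HB Require Import structures.
From mathcomp Require Import all_boot all_order all_algebra.
From mathcomp Require Import boolp classical_sets reals topology normedtype.
From mathcomp Require Import sequences exp.
Set Implicit Arguments.
Unset Strict Implicit.
Unset Printing Implicit Defensive.
Import Order.TTheory GRing.Theory Num.Theory.
Import numFieldNormedType.Exports.
Local Open Scope ring_scope.

Section CliqueColouring.
Variables (T : finType) (e : rel T).

Definition clique (A : {set T}) : bool :=
  [forall u in A, forall v in A, (u != v) ==> e u v].

Definition maximal_clique (A : {set T}) : bool := maxset clique A.

Definition monochromatic (C : finType) (c : T -> C) (A : {set T}) : bool :=
  [exists i : C, forall v in A, c v == i].

(* A maximal clique of size 1 is an isolated vertex; these are ignored. *)
Definition clique_colouring (C : finType) (c : T -> C) : bool :=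
  [forall A : {set T}, maximal_clique A && (1 < #|A|)%N ==> ~~ monochromatic c A].

Definition clique_colourable (k : nat) : bool :=
  [exists c : {ffun T -> 'I_k}, clique_colouring c].

Lemma clique_colourable_ex : exists k, clique_colourable k.
Proof.
exists #|T|; apply/existsP; exists [ffun v => enum_rank v].
apply/forallP => A; apply/implyP => /andP[_ /card_gt1P[u [v [uA vA uv]]]].
apply/negP => /existsP[i /forall_inP h]; case/eqP: uv; apply: enum_rank_inj.
by have /eqP := h u uA; have /eqP := h v vA; rewrite !ffunE => -> ->.
Qed.

Definition clique_chromatic_number : nat := ex_minn clique_colourable_ex.

End CliqueColouring.

Definition edge (n : nat) : finType := {e : {set 'I_n} | #|e| == 2%N}.

(* Graphs on the vertex set [n], given by their edge sets. *)
Definition graph (n : nat) : finType := {set edge n}.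

Definition adj (n : nat) (G : graph n) : rel 'I_n :=
  fun u v => [exists e in G, val e == [set u; v]%SET].

Definition chi_c (n : nat) (G : graph n) : nat :=
  clique_chromatic_number (adj G).

Section RandomGraph.
Variable R : realType.

(* The law of G(n,p): each pair is an edge independently with probability p. *)
Definition gnp_mass (n : nat) (p : R) (G : graph n) : R :=
  \prod_(e : edge n) (if e \in G then p else 1 - p).

Definition gnp_prob (n : nat) (p : R) (A : pred (graph n)) : R :=
  \sum_(G : graph n | A G) gnp_mass p G.

Local Open Scope classical_set_scope.

Definition whp (p : nat -> R) (A : forall n, pred (graph n)) : Prop :=
  gnp_prob (p n) (A n) @[n --> \oo] --> (1 : R).

(* u n = n ^ (x + o(1)) as n tends to infinity. *)
Definition eq_pow_o1 (u : nat -> R) (x : R) : Prop :=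
  exists2 eps : nat -> R, eps n @[n --> \oo] --> (0 : R) &
    \forall n \near \oo, u n = n%:R `^ (x + eps n).

(* chi_c(G) = n ^ (y + o(1)) with high probability, for G in G(n, p n). *)
Definition whp_chi_c_eq_pow_o1 (p : nat -> R) (y : R) : Prop :=
  exists2 delta : nat -> R, delta n @[n --> \oo] --> (0 : R) &
    whp p (fun n G =>
      n%:R `^ (y - delta n) <= (chi_c G)%:R <= n%:R `^ (y + delta n)).

(* Only the values for 0 < x < 1 are meaningful. *)
Definition f (x : R) : R :=
  if x < 1 / 2 then x
  else if x < 3 / 5 then 1 + 3 * (x - 1) / 2
  else 1 - x.

End RandomGraph.

(* Main.v *)
(* Put p = n^(x-1+o(1)).

   Upper bounds. For x < 1/2 colour greedily with maxdeg + 1 colours. For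
   x >= 3/5 about 1/p vertices dominate the graph, and colouring each vertex by
   a neighbour among them leaves no maximal clique monochromatic. For
   1/2 < x < 3/5 every edge lies in a triangle, so it suffices to avoid
   monochromatic triangles. Cut the vertices into blocks of size s just below
   p^(-3/2); a vertex v closes about s^2 p^3 << 1 triangles inside its block, so
   the edges spanned by its neighbours in the block have a vertex cover of
   bounded size; greedily giving v a colour not used on that cover takes boundedly
   many colours per block.

   Lower bound. Choose k with n p^k << 1 and let S be any set of
   s >> max(p^(-k/2), p n) vertices. A k-clique of G inside S extends to a
   maximal clique of G[S], so if S contains no maximal clique of G then every
   k-clique in S lies in the neighbourhood of a vertex outside S. These
   neighbourhoods cover only a small proportion of the k-subsets of S, and they
   are independent of G[S], in which by Janson's inequality some uncovered
   k-subset is a clique with probability 1 - exp(-s n^c). This beats the number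
   of sets S, so colour classes have fewer than s vertices. The value k = 2 or 3,
   or k = floor(1/(1-x)) + 1 when x >= 2/3, gives n/s = n^(f(x)-o(1)). *)
Require Import Defs.
From HB Require Import structures.
From mathcomp Require Import all_boot all_order all_algebra.
From mathcomp Require Import boolp classical_sets reals topology normedtype.
From mathcomp Require Import sequences exp.
From mathcomp Require Import zify ring lra.
(* Repeated so that [set0], [subsetP] etc. refer to finite sets, not classical ones. *)
From mathcomp Require Import fintype finset.
Set Implicit Arguments.
Unset Strict Implicit.
Unset Printing Implicit Defensive.
Import Order.TTheory GRing.Theory Num.Theory.
Import numFieldNormedType.Exports.
Local Open Scope ring_scope.

(** * Random subsets *)

Section RandomSubset.
Variables (R : realType) (E : finType) (p : R).
Hypothesis p01 : 0 <= p <= 1.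
Implicit Types (F G : {set E}) (h : {set E} -> R).

Definition mass G : R := \prod_(e : E) (if e \in G then p else 1 - p).

Definition expect h : R := \sum_G mass G * h G.

Lemma mass_ge0 G : 0 <= mass G.
Proof.
by apply: prodr_ge0 => e _; case: ifP => _; case/andP: p01; rewrite ?subr_ge0.
Qed.

Lemma eq_expect h1 h2 : h1 =1 h2 -> expect h1 = expect h2.
Proof. by move=> eqh; apply: eq_bigr => G _; rewrite eqh. Qed.

Lemma le_expect h1 h2 : (forall G, h1 G <= h2 G) -> expect h1 <= expect h2.
Proof. by move=> leh; apply: ler_sum => G _; rewrite ler_wpM2l// mass_ge0. Qed.

Lemma expect_ge0 h : (forall G, 0 <= h G) -> 0 <= expect h.
Proof. by move=> h0; apply: sumr_ge0 => G _; rewrite mulr_ge0// mass_ge0. Qed.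

Lemma expectD h1 h2 : expect (fun G => h1 G + h2 G) = expect h1 + expect h2.
Proof. by rewrite -big_split; apply: eq_bigr => G _; rewrite mulrDr. Qed.

Lemma expectZ a h : expect (fun G => a * h G) = a * expect h.
Proof. by rewrite mulr_sumr; apply: eq_bigr => G _; rewrite mulrCA. Qed.

Lemma expectB h1 h2 : expect (fun G => h1 G - h2 G) = expect h1 - expect h2.
Proof.
by rewrite -sumrB; apply: eq_bigr => G _; rewrite mulrBr.
Qed.

Lemma expect_sum (I : Type) (r : seq I) (P : pred I) (h : I -> {set E} -> R) :
  expect (fun G => \sum_(i <- r | P i) h i G) = \sum_(i <- r | P i) expect (h i).
Proof.
by rewrite exchange_big; apply: eq_bigr => G _; rewrite mulr_sumr.
Qed.

Lemma expect_prod (g : E -> R) :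
  expect (fun G => \prod_(e in G) g e) = \prod_(e : E) (p * g e + (1 - p)).
Proof.
rewrite bigA_distr; apply: eq_bigr => G _.
rewrite [X in _ * X]big_mkcond -big_split /=.
by apply: eq_bigr => e _; case: ifP => _; rewrite ?mulr1.
Qed.

Lemma expect1 : expect (fun=> 1) = 1.
Proof.
have := expect_prod (fun=> 1); rewrite [RHS]big1 => [h|e _]; last by ring.
by rewrite -[RHS]h; apply: eq_expect => G; rewrite big1.
Qed.

(** Deleting [e] matches the sets containing [e] with those avoiding it. Once the factor of [e] is
    split off the mass, both classes give the same sum [S], with weights [p] and [1 - p] on the
    right-hand side. *)
Lemma expect_mem e h :
  expect (fun G => (e \in G)%:R * h G) = p * expect (fun G => h (e |: G)).
Proof.
pose m G := \prod_(e' | e' != e) (if e' \in G then p else 1 - p).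
have massE G : mass G = (if e \in G then p else 1 - p) * m G.
  by rewrite /mass (bigD1 e).
have mE F G : (forall e', e' != e -> (e' \in F) = (e' \in G)) -> m F = m G.
  by move=> FG; apply: eq_bigr => e' e'e; rewrite FG.
pose S := \sum_(G : {set E} | e \in G) m G * h G.
have SE : \sum_(G : {set E} | e \notin G) m G * h (e |: G) = S.
  rewrite /S [RHS](reindex_onto (fun G : {set E} => e |: G)
                                (fun G => G :\ e)) /=; last first.
    by move=> G eG; rewrite setD1K.
  apply: eq_big => [G|G enG].
    by rewrite setU11 /=; apply/idP/eqP => [/setU1K//|<-]; rewrite setD11.
  by congr (_ * _); apply: mE => e' /negbTE e'e; rewrite !inE e'e.
have -> : expect (fun G => h (e |: G)) = S.
  rewrite /expect (bigID (fun G : {set E} => e \in G)) /=.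
  rewrite -[RHS](_ : p * S + (1 - p) * S = S); last by ring.
  rewrite -{2}SE /S !mulr_sumr; congr (_ + _).
    apply: eq_bigr => G eG; rewrite massE eG mulrA.
    by rewrite (setUidPr _) ?sub1set.
  by apply: eq_bigr => G enG; rewrite massE (negbTE enG) mulrA.
rewrite /expect /S mulr_sumr [RHS]big_mkcond; apply: eq_bigr => G _.
by rewrite massE; case: ifP => eG /=; ring.
Qed.

(* Conditioning on [F \subset G] amounts to adding [F] to [G]; this identity
   replaces both independence and the Harris inequality. *)
Lemma expect_sub F h :
  expect (fun G => (F \subset G)%:R * h G)
  = p ^+ #|F| * expect (fun G => h (F :|: G)).
Proof.
have [n] := ubnP #|F|; elim: n F h => // n IH F h Fn.
have [->|[e eF]] := set_0Vmem F.
  rewrite cards0 mul1r; apply: eq_expect => G.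
  by rewrite sub0set mul1r set0U.
rewrite (cardsD1 e F) eF exprS -mulrA.
have -> : expect (fun G => (F \subset G)%:R * h G)
    = expect (fun G => (e \in G)%:R * ((F :\ e \subset G)%:R * h G)).
  apply: eq_expect => G; rewrite mulrA -natrM mulnb; congr (_%:R * _).
  by rewrite -{1}(setD1K eF) subUset sub1set.
rewrite expect_mem; congr (_ * _).
rewrite (eq_expect (h2 := fun G => (F :\ e \subset G)%:R * h (e |: G))) => [|G].
  rewrite (IH _ (fun G => h (e |: G))); last by move: Fn; rewrite (cardsD1 e F) eF.
  congr (_ * _); apply: eq_expect => G.
  by rewrite setUA setD1K.
congr (_%:R * _); congr (nat_of_bool _).
apply/idP/idP => [/subsetP FG|FG]; last exact: subset_trans FG (subsetUr _ _).
apply/subsetP => e' e'F; have := FG _ e'F; rewrite !inE.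
by move: e'F; rewrite !inE => /andP[/negbTE ->].
Qed.

Definition prob (A : pred {set E}) : R := expect (fun G => (A G)%:R).

Lemma prob_ge0 A : 0 <= prob A.
Proof. by apply: expect_ge0 => G; rewrite ler0n. Qed.

Lemma le_prob (A B : pred {set E}) :
  (forall G, A G -> B G) -> prob A <= prob B.
Proof.
move=> AB; apply: le_expect => G; rewrite ler_nat.
by have := AB G; case: (A G) => // ->.
Qed.

Lemma prob_le1 A : prob A <= 1.
Proof. by rewrite -expect1; apply: le_expect => G; case: (A G). Qed.

Lemma probC A : prob (fun G => ~~ A G) = 1 - prob A.
Proof.
rewrite -expect1 -expectB; apply: eq_expect => G.
by case: (A G); rewrite ?subrr ?subr0.
Qed.

Lemma prob_union (I : finType) (P : pred I) (A : I -> pred {set E}) :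
  prob (fun G => [exists (i | P i), A i G]) <= \sum_(i | P i) prob (A i).
Proof.
rewrite -expect_sum; apply: le_expect => G.
have [/exists_inP[i Pi Ai]|_] := boolP [exists (i | P i), A i G]; last first.
  by apply: sumr_ge0 => i _; rewrite ler0n.
by rewrite (bigD1 i) //= Ai lerDl; apply: sumr_ge0 => j _; rewrite ler0n.
Qed.

Lemma prob_or (A B : pred {set E}) :
  prob (fun G => A G || B G) <= prob A + prob B.
Proof.
rewrite -expectD; apply: le_expect => G.
by rewrite -natrD ler_nat; case: (A G); case: (B G).
Qed.

Lemma expR1_le4 : expR 1 <= 4 :> R.
Proof.
have h : (1 / 2 : R) <= expR (- (1 / 2)) by have := expR_ge1Dx (- (1 / 2) : R); lra.
have e0 := expR_gt0 (1 / 2 : R).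
have hM : expR (1 / 2) * expR (- (1 / 2)) = 1 :> R by rewrite -expRD subrr expR0.
have -> : expR 1 = expR (1 / 2) * expR (1 / 2) :> R by rewrite -expRD; congr expR; lra.
have : expR (1 / 2) <= 2 :> R by nra.
by nra.

Qed.

(** The exponential moment method: the indicator is at most exp(|G :&: B| - m), and each element of
    [B] contributes 1 + p (e - 1) <= 1 + 3 p <= exp(3 p), using e <= 4. *)
Lemma prob_tail (B : {set E}) (m : R) :
  prob (fun G => m <= #|G :&: B|%:R) <= expR (3 * p * #|B|%:R - m).
Proof.
have p0 : 0 <= p by case/andP: p01.
apply: (@le_trans _ _ (expect (fun G => expR (- m) *
    \prod_(e in G) (if e \in B then expR 1 else 1)))).
  apply: le_expect => G; rewrite -big_mkcondr /= big_const.
  have -> : #|[pred e | (e \in G) && (e \in B)]| = #|G :&: B|.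
    by apply: eq_card => e; rewrite !inE.
  rewrite iter_mulr_1 -expRM_natl mulr1 -expRD.
  have [mB|_] := boolP (m <= _); last by rewrite ltW ?expR_gt0.
  by rewrite -[true%:R]expR0 ler_expR addrC subr_ge0.
rewrite expectZ expect_prod mulrC addrC expRD ler_wpM2r ?expR_ge0 //.
rewrite addrC; apply: (@le_trans _ _ (\prod_(e in B) expR (3 * p))).
  rewrite [leRHS]big_mkcond; apply: ler_prod => e _.
  case: ifP => _; last first.
    by rewrite mulr1 subrKC; case/andP: p01; rewrite ler01 lexx.
  have := expR_ge1Dx (3 * p); have := expR1_le4; have := expR_gt0 (1 : R).
  case/andP: p01; nra.
by rewrite big_const iter_mulr_1 -expRM_natr.
Qed.

End RandomSubset.

(** * Janson's inequality *)

(** The Weierstrass product inequality. *)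
Lemma prod_1B_ge (R : realDomainType) (I : Type) (r : seq I) (P : pred I)
    (x : I -> R) : (forall i, P i -> 0 <= x i <= 1) ->
  1 - \sum_(i <- r | P i) x i <= \prod_(i <- r | P i) (1 - x i).
Proof.
move=> x01; elim: r => [|i r IH]; first by rewrite !big_nil subr0.
rewrite !big_cons; case: ifP => // Pi.
have /andP[x0 x1] := x01 i Pi.
have : 0 <= \sum_(j <- r | P j) x j by apply: sumr_ge0 => j /x01/andP[].
nra.
Qed.

Lemma prod_le1 (R : realDomainType) (I : Type) (r : seq I) (P : pred I)
    (x : I -> R) : (forall i, P i -> 0 <= x i <= 1) ->
  \prod_(i <- r | P i) x i <= 1.
Proof.
move=> x01; apply: (@le_trans _ _ (\prod_(i <- r | P i) 1)); last by rewrite big1.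
exact: ler_prod.
Qed.

Section Janson.
Variables (R : realType) (E : finType) (p : R).
Hypothesis p01 : 0 <= p <= 1.
Variables (I : eqType) (F : I -> {set E}) (t : R).
Hypothesis t01 : 0 <= t <= 1.
Implicit Types (r : seq I) (G : {set E}).

(** Each event is thinned, being kept with probability [t]. This multiplies the first moment by [t]
    but the correlation term by [t ^+ 2], so a small [t] helps when correlations are large. *)
Let w i G : R := 1 - t * (F i \subset G)%:R.

Let w01 i G : 0 <= w i G <= 1.
Proof. by rewrite /w; case: (_ \subset _) => /=; case/andP: t01; lra. Qed.

(** The correlation term Delta of Janson's inequality, summed over ordered pairs. *)
Definition janson_cov r : R :=
  \sum_(i <- r) \sum_(j <- r | (j != i) && ~~ [disjoint F i & F j])
    p ^+ #|F i :|: F j|.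

(* The Boppana-Spencer argument. The factor [h] leaves room for conditioning on
   the part of the random set which meets no [F i]. *)
Lemma janson r (h : {set E} -> R) : uniq r -> (forall G, 0 <= h G) ->
    (forall i G, i \in r -> h (F i :|: G) = h G) ->
  expect p (fun G => h G * \prod_(i <- r) (1 - t * (F i \subset G)%:R))
  <= expect p h * expR (- (t * \sum_(i <- r) p ^+ #|F i|)
                        + t ^+ 2 * janson_cov r).
Proof.
have [p0 p1] := andP p01; have [t0 t1] := andP t01.
move=> + h0; elim: r => [|i r IH] /=.
  move=> _ _; rewrite /janson_cov !big_nil !mulr0 oppr0 addr0 expR0 mulr1.
  by apply: le_expect => // G; rewrite big_nil mulr1.
move=> /andP[ir r_uniq] hF.
have hFr j G : j \in r -> h (F j :|: G) = h G.
  by move=> jr; apply: hF; rewrite inE jr orbT.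
have hFi G : h (F i :|: G) = h G by apply: hF; rewrite inE eqxx.
(* [Z] collects the factors unaffected by adding [F i], and [Y] the factors whose sets meet
   [F i]. *)
pose W G := \prod_(j <- r) w j G.
pose Z G := \prod_(j <- r | [disjoint F i & F j]) w j G.
pose Y G := \prod_(j <- r | ~~ [disjoint F i & F j]) w j G.
have WE G : W G = Z G * Y G by rewrite /W (bigID (fun j => [disjoint F i & F j])).
have Z01 G : 0 <= Z G <= 1.
  rewrite prodr_ge0 => [|j _]; last by have /andP[] := w01 j G.
  by rewrite /Z prod_le1.
have Y1 G : Y G <= 1 by rewrite /Y prod_le1.
have Y0 G : 0 <= Y G.
  by rewrite prodr_ge0 => [|j _]; last by have /andP[] := w01 j G.
have ZF G : Z (F i :|: G) = Z G.
  apply: eq_bigr => j dij; congr (1 - t * (nat_of_bool _)%:R).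
  apply/idP/idP => [/subsetP FG|FG].
    apply/subsetP => e ej; have := FG e ej; rewrite inE => /orP[ei|//].
    by have /pred0P/(_ e) := dij; rewrite /= ei ej.
  exact: subset_trans FG (subsetUr _ _).
have Zdec H G : Z (H :|: G) <= Z G.
  apply: ler_prod => j _; have /andP[-> _] /= := w01 j (H :|: G).
  rewrite lerB // ler_wpM2l // ler_nat; have [jG|//] := boolP (F j \subset G).
  by rewrite (subset_trans jG) ?subsetUr.
pose z := expect p (fun G => h G * Z G).
pose ov := \sum_(j <- r | ~~ [disjoint F i & F j]) p ^+ #|F i :|: F j|.
(* Bound [Y] below by 1 minus the sum of its deficits. Conditioning on [F i] leaves [h] and [Z]
   unchanged, while conditioning on [F i :|: F j] can only decrease [Z]. *)
have step : (p ^+ #|F i| - t * ov) * z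
    <= expect p (fun G => (F i \subset G)%:R * (h G * W G)).
  have Ei : expect p (fun G => (F i \subset G)%:R * (h G * Z G))
      = p ^+ #|F i| * z.
    rewrite (expect_sub p (F i) (fun G => h G * Z G)); congr (_ * _).
    by apply: eq_expect => G; rewrite hFi ZF.
  have Eij j : j \in r ->
      expect p (fun G => (F i :|: F j \subset G)%:R * (h G * Z G))
      <= p ^+ #|F i :|: F j| * z.
    move=> jr; rewrite (expect_sub p _ (fun G => h G * Z G)).
    rewrite ler_wpM2l ?exprn_ge0 //; apply: le_expect => // G.
    by rewrite -setUA hFi hFr // ZF ler_wpM2l.
  apply: (@le_trans _ _ (expect p (fun G => (F i \subset G)%:R * (h G * Z G)
      - t * \sum_(j <- r | ~~ [disjoint F i & F j])
              (F i :|: F j \subset G)%:R * (h G * Z G)))).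
    rewrite expectB expectZ expect_sum Ei mulrBl -mulrA mulr_suml.
    rewrite lerB // ler_wpM2l // big_seq_cond [leRHS]big_seq_cond.
    by apply: ler_sum => j /andP[jr _]; apply: Eij.
  apply: le_expect => // G.
  under eq_bigr => j _ do rewrite subUset -mulnb natrM.
  have [_ /=|_] := boolP (F i \subset G); last first.
    by rewrite !mul0r big1 ?mulr0 ?subr0 // => j _; rewrite mul0r mul0r.
  rewrite !mul1r WE; under eq_bigr => j _ do rewrite mul1r.
  rewrite -mulr_suml.
  have hZ : 0 <= h G * Z G by rewrite mulr_ge0 //; case/andP: (Z01 G).
  have : 1 - \sum_(j <- r | ~~ [disjoint F i & F j]) t * (F j \subset G)%:R <= Y G.
    by apply: prod_1B_ge => j _; have := w01 j G; rewrite /w; lra.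
  rewrite -mulr_sumr; nra.
pose y := expect p (fun G => h G * W G).
have y0 : 0 <= y.
  by apply: expect_ge0 => // G; rewrite WE !mulr_ge0 //; case/andP: (Z01 G).
have yz : y <= z.
  apply: le_expect => // G; rewrite ler_wpM2l // WE.
  by rewrite -[leRHS]mulr1 ler_wpM2l //; case/andP: (Z01 G).
have ylt : expect p (fun G => h G * \prod_(j <- i :: r) w j G)
    <= y * expR (- (t * (p ^+ #|F i| - t * ov))).
  have -> : expect p (fun G => h G * \prod_(j <- i :: r) w j G)
      = y - t * expect p (fun G => (F i \subset G)%:R * (h G * W G)).
    rewrite -expectZ -expectB; apply: eq_expect => G.
    by rewrite big_cons -/(W G) /w; ring.
  have /= := expR_ge1Dx (- (t * (p ^+ #|F i| - t * ov))).
  (* If the bracket is nonnegative, [z] may be replaced by the smaller [y] in [step]; otherwise the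
     exponential is at least 1 and dropping the factor of [i] suffices. *)
  have [b0|b0] := leP 0 (p ^+ #|F i| - t * ov).
    set e := expR _ => e1.
    have : t * ((p ^+ #|F i| - t * ov) * y)
        <= t * expect p (fun G => (F i \subset G)%:R * (h G * W G)).
      by rewrite ler_wpM2l // (le_trans _ step) // ler_wpM2l.
    have := ler_wpM2l y0 e1; lra.
  set e := expR _ => e1.
  have : 0 <= t * expect p (fun G => (F i \subset G)%:R * (h G * W G)).
    rewrite mulr_ge0 // expect_ge0 // => G.
    by rewrite WE !mulr_ge0 ?ler0n //; case/andP: (Z01 G).
  have e1' : 1 <= e.
    by apply: le_trans e1; rewrite lerDl oppr_ge0 mulr_ge0_le0 // ltW.
  have : y * 1 <= y * e by rewrite ler_wpM2l.
  lra.
apply: (le_trans ylt).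
apply: (@le_trans _ _ (expect p h * expR (- (t * \sum_(j <- r) p ^+ #|F j|)
    + t ^+ 2 * janson_cov r) * expR (- (t * (p ^+ #|F i| - t * ov))))).
  by rewrite ler_wpM2r ?expR_ge0 //; apply: IH.
rewrite -mulrA -expRD ler_wpM2l ?expect_ge0 // ler_expR big_cons.
(* The pairs with first entry [i] account for [ov]; the pairs with second entry [i] only add
   nonnegative terms. *)
have : janson_cov r + ov <= janson_cov (i :: r); last first.
  have := sqr_ge0 t; nra.
rewrite /janson_cov big_cons addrC lerD //.
  rewrite big_cons eqxx /= /ov [leLHS]big_seq_cond [leRHS]big_seq_cond.
  rewrite le_eqVlt; apply/orP; left; apply/eqP; apply: eq_bigl => j.
  have [jr/=|//] := boolP (j \in r).
  by have -> : j != i by apply: contraNneq ir => <-.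
apply: ler_sum => j _; rewrite big_cons.
by case: ifP => // _; rewrite lerDr exprn_ge0.
Qed.

(** When no [F i] is contained in [G], every factor of the thinned product is 1, so the product
    dominates the indicator. *)
Lemma janson_avoid r (h : {set E} -> R) : uniq r -> (forall G, 0 <= h G) ->
    (forall i G, i \in r -> h (F i :|: G) = h G) ->
  expect p (fun G => h G * (all (fun i => ~~ (F i \subset G)) r)%:R)
  <= expect p h * expR (- (t * \sum_(i <- r) p ^+ #|F i|)
                        + t ^+ 2 * janson_cov r).
Proof.
move=> ur h0 hF; apply: le_trans (janson ur h0 hF).
apply: le_expect => // G; rewrite ler_wpM2l //.
have [/allP rG|_] := boolP (all _ _).
  rewrite big_seq big1 // => i /rG /negbTE ->; by rewrite mulr0 subr0.
by apply: prodr_ge0 => i _; have /andP[] := w01 i G.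
Qed.

End Janson.

(** For disjoint sets the correlation term vanishes, and Janson's inequality is used with [t = 1]
    and constant [h]. *)
Lemma prob_avoid_disjoint (R : realType) (E : finType) (p : R) (I : eqType)
    (F : I -> {set E}) (r : seq I) : 0 <= p <= 1 -> uniq r ->
    {in r &, forall i j, i != j -> [disjoint F i & F j]} ->
  prob p (fun G => all (fun i => ~~ (F i \subset G)) r)
  <= expR (- \sum_(i <- r) p ^+ #|F i|).
Proof.
move=> p01 ur dF.
have t01 : 0 <= (1 : R) <= 1 by rewrite ler01 lexx.
have cov0 : janson_cov p F r = 0; last first.
  have := @janson_avoid R E p p01 I F 1 t01 r (fun=> 1) ur (fun=> ler01)
            (fun _ _ _ => erefl).
  rewrite expect1 cov0 mulr0 addr0 !mul1r; apply: le_trans.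
  by apply: le_expect => // G; rewrite mul1r.
rewrite /janson_cov big_seq big1 // => i ir; rewrite big_seq_cond big_pred0 // => j.
have [jr/=|//] := boolP (j \in r).
by have [//|/= ji] := eqVneq j i; rewrite dF // eq_sym.
Qed.

(** * Clique colourings *)

Section CliqueColouringTheory.
Variables (T : finType) (e : rel T).
Hypotheses (e_sym : symmetric e) (e_irr : irreflexive e).
Implicit Types (A Q S : {set T}) (u v w : T).

Lemma cliqueP A :
  reflect {in A &, forall u v, u != v -> e u v} (clique e A).
Proof.
apply: (iffP forall_inP) => [h u v uA vA|h u uA].
  by move/forall_inP: (h u uA) => /(_ v vA)/implyP.
by apply/forall_inP => v vA; apply/implyP => /(h u v uA vA).
Qed.

Lemma clique_setU1 A w :
  clique e A -> {in A, forall u, e u w} -> clique e (w |: A).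
Proof.
move=> /cliqueP cA wA; apply/cliqueP => u v /setU1P[->|uA] /setU1P[->|vA].
- by rewrite eqxx.
- by rewrite e_sym => _; apply: wA.
- by move=> _; apply: wA.
- exact: cA.
Qed.

(** Such a [w] could be added to [A], so by maximality it would lie in [A] and be adjacent to
    itself. *)
Lemma maximal_clique_ext A w : maximal_clique e A -> ~ {in A, forall u, e u w}.
Proof.
move=> /maxsetP[cA maxA] wA.
have wAA : w \in A by rewrite -(maxA _ (clique_setU1 cA wA)) ?setU11 ?subsetUr.
by have := wA w wAA; rewrite e_irr.
Qed.

Lemma clique_chromatic_number_le (C : finType) (c : T -> C) :
  clique_colouring e c -> (clique_chromatic_number e <= #|C|)%N.
Proof.
move=> cc; rewrite /clique_chromatic_number; case: ex_minnP => m _; apply.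
apply/existsP; exists [ffun v => enum_rank (c v)]; apply/forallP => A.
apply/implyP => hA; have := forallP cc A; rewrite hA /=.
apply: contra => /existsP[i /forall_inP ci].
apply/existsP; exists (enum_val i); apply/forall_inP => v /ci.
by rewrite ffunE => /eqP <-; rewrite enum_rankK.
Qed.

Lemma clique_chromatic_number_colouring :
  exists c : T -> 'I_(clique_chromatic_number e), clique_colouring e c.
Proof.
rewrite /clique_chromatic_number; case: ex_minnP => m /existsP[c cc] _.
by exists c.
Qed.

Section Colourings.
Variables (C : finType) (c : T -> C).

Lemma clique_colouring_edge :
  (forall u v, e u v -> c u != c v) -> clique_colouring e c.
Proof.
move=> hc; apply/forallP => A; apply/implyP => /andP[/maxsetP[/cliqueP cA _]].
move=> /card_gt1P[u [v [uA vA uv]]]; apply/negP => /existsP[i /forall_inP ci].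
have := hc u v (cA u v uA vA uv).
by rewrite (eqP (ci u uA)) (eqP (ci v vA)) eqxx.
Qed.

(** A maximal clique [A] with an edge [uv] cannot be just that edge: the common neighbour [w] does
    not extend [A], so some [z] in [A] is not adjacent to [w]. Then [z] differs from [u] and [v],
    and [u], [v], [z] form a triangle in [A]. *)
Lemma clique_colouring_triangle :
    (forall u v, e u v -> exists w, e u w && e v w) ->
    (forall u v w, e u v -> e u w -> e v w -> c u = c v -> c u = c w -> False) ->
  clique_colouring e c.
Proof.
move=> ext hc; apply/forallP => A; apply/implyP => /andP[mA].
have /maxsetP[/cliqueP cA _] := mA.
move=> /card_gt1P[u [v [uA vA uv]]]; apply/negP => /existsP[i /forall_inP ci].
have euv := cA u v uA vA uv; have [w /andP[uw vw]] := ext u v euv.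
have [z zA /negP ezw] : exists2 z, z \in A & ~~ e z w.
  apply/exists_inP; rewrite -[X in is_true X]negbK negb_exists_in.
  apply/negP => /forall_inP h; apply: (@maximal_clique_ext A w mA) => z zA.
  by have := h z zA; rewrite negbK.
have zu : u != z by apply/eqP => zu; case: ezw; rewrite -zu.
have zv : v != z by apply/eqP => zv; case: ezw; rewrite -zv.
apply: (hc u v z euv (cA _ _ uA zA zu) (cA _ _ vA zA zv)).
  by rewrite (eqP (ci u uA)) (eqP (ci v vA)).
by rewrite (eqP (ci u uA)) (eqP (ci z zA)).
Qed.

(** All vertices of colour [i] are adjacent to [d i], which would extend any maximal clique of that
    colour. *)
Lemma clique_colouring_dominated (d : C -> T) :
  (forall v, e v (d (c v))) -> clique_colouring e c.
Proof.
move=> hd; apply/forallP => A; apply/implyP => /andP[mA _].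
apply/negP => /existsP[i /forall_inP ci].
by apply: (@maximal_clique_ext A (d i) mA) => v vA; rewrite -(eqP (ci v vA)).
Qed.

(* A clique inside a colour class extends to a maximal one inside the class,
   which is not maximal in the whole graph. *)
Lemma clique_colouring_covered S Q i :
    clique_colouring e c -> {in S, forall v, c v = i} ->
    Q \subset S -> (1 < #|Q|)%N -> clique e Q ->
  exists2 w, w \notin S & {in Q, forall u, e u w}.
Proof.
move=> cc cS QS Q1 cQ.
have hQ : clique e Q && (Q \subset S) by rewrite cQ QS.
have [A /maxsetP[/andP[cA AS] maxA] QA] :=
  @maxset_exists T (fun A => clique e A && (A \subset S)) Q hQ.
have nmA : ~~ maximal_clique e A.
  apply/negP => mA; have := forallP cc A; rewrite mA (leq_trans Q1) ?subset_leq_card //=.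
  move=> /negP[]; apply/existsP; exists i; apply/forall_inP => v vA.
  by rewrite cS //; apply: (subsetP AS).
have [B [cB AB BA]] : exists B, [/\ clique e B, A \subset B & B != A].
  apply: contrapT => h; move/negP: nmA; apply.
  apply/maxsetP; split => // B cB AB; apply: contrapT => /eqP BA; apply: h.
  by exists B.
have /subsetPn[w wB wA] : ~~ (B \subset A).
  by apply: contra BA => BA; rewrite eqEsubset BA.
have adjw : {in A, forall u, e u w}.
  move=> u uA; apply: (cliqueP _ cB) => //; first exact: (subsetP AB).
  by apply: contraNneq wA => <-.
exists w; last by move=> u uQ; apply: adjw; apply: (subsetP QA).
apply: contra wA => wS; rewrite -(maxA (w |: A)) ?setU11 ?subsetUr //.
by rewrite clique_setU1 //= subUset sub1set wS AS.
Qed.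

End Colourings.
End CliqueColouringTheory.

(** Vertices are coloured in increasing order. [C v] will be either the neighbourhood of [v] or a
    vertex cover of the edges in its link. *)
Lemma greedy_colouring n d (C : 'I_n -> {set 'I_n}) :
    (forall v, (#|C v| <= d)%N) ->
  exists c : 'I_n -> 'I_d.+1,
    forall u v, u \in C v -> (u < v)%N -> c u != c v.
Proof.
move=> Cd; suff /(_ n)[c hc] : forall m, exists c : 'I_n -> 'I_d.+1,
    forall u v : 'I_n, u \in C v -> (u < v < m)%N -> c u != c v.
  by exists c => u v uC uv; apply: hc; rewrite ?uv ?ltn_ord.
elim=> [|m [c hc]]; first by exists (fun=> ord0) => u v _; rewrite ltn0 andbF.
have [nm|mn] := leqP n m.
  exists c => u v uC /andP[uv _]; apply: hc => //.
  by rewrite uv (leq_trans (ltn_ord v)).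
pose vm := Ordinal mn.
have [i /negP ic] : exists i, ~~ (i \in c @: C vm).
  apply/existsP; rewrite -[X in is_true X]negbK negb_exists; apply/negP => /forallP h.
  have : (#|'I_d.+1| <= #|c @: C vm|)%N.
    by apply/subset_leq_card/subsetP => i _; have := h i; rewrite negbK.
  by rewrite card_ord leqNgt ltnS (leq_trans (leq_imset_card _ _)).
exists (fun v => if v == vm then i else c v) => u v uC /andP[uv vm1].
have unm : u != vm.
  by apply: contraTneq uv => ->; rewrite -leqNgt /= -ltnS.
rewrite (negbTE unm); have [vE|vnm] := eqVneq v vm.
  by apply/eqP => ci; apply: ic; rewrite -ci imset_f // -vE.
apply: hc => //; rewrite uv /=.
by move: vm1; rewrite ltnS leq_eqVlt => /orP[/eqP vE|//]; case/eqP: vnm; apply: val_inj.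
Qed.

Lemma pigeonhole_class (T : finType) k s (c : T -> 'I_k) :
    (0 < s)%N -> (0 < #|T|)%N -> (k * s <= #|T|)%N ->
  exists i (S : {set T}), #|S| = s /\ {in S, forall v, c v = i}.
Proof.
move=> s0 T0 ksT.
have [i si] : exists i, (s <= #|[set v | c v == i]|)%N.
  apply/existsP; rewrite -[X in is_true X]negbK negb_exists; apply/negP => /forallP h.
  move: ksT; apply/negP; rewrite -ltnNge -cardsT.
  have k0 : (0 < k)%N.
    case: (posnP k) => // k0; have /card_gt0P[v _] := T0.
    by have := ltn_ord (c v); rewrite {2}k0.
  have -> : #|[set: T]| = (\sum_(i < k) #|[set v | c v == i]|)%N.
    rewrite -sum1_card (partition_big c xpredT) //=; apply: eq_bigr => i _.
    by rewrite -sum1_card; apply: eq_bigl => v; rewrite !inE.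
  apply: (@leq_ltn_trans (\sum_(i < k) s.-1)).
    by apply: leq_sum => i _; have := h i; rewrite -ltnNge -{1}(prednK s0) ltnS.
  by rewrite sum_nat_const card_ord ltn_pmul2l // prednK.
(* The class is cut down to exactly [s] vertices, so that later union bounds run over sets of one
   size. *)
have /card_geqP[r [ur <- rc]] := si.
exists i, [set v in r]; split; first by rewrite cardsE; apply/card_uniqP.
by move=> v; rewrite inE => /rc; rewrite inE => /eqP.
Qed.

(** * Upper bounds for G(n,p) *)

Section EdgeSets.
Variable n : nat.
Implicit Types (G F : {set edge n}) (A Q S W : {set 'I_n}) (u v w : 'I_n).

(** Turns adjacency and cliques into inclusions of edge sets in [G], the form to which the lemmas on
    random subsets apply. *)
Definition edges_in A : {set edge n} := [set e : edge n | val e \subset A].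

Lemma edges_inI A Q : edges_in A :&: edges_in Q = edges_in (A :&: Q).
Proof. by apply/setP => e; rewrite !inE subsetI. Qed.

Lemma card_edges_in A : #|edges_in A| = 'C(#|A|, 2).
Proof.
rewrite -cards_draws -(card_imset _ val_inj); apply: eq_card => B.
apply/imsetP/idP => [[e eA ->]|]; first by move: eA; rewrite !inE (valP e) andbT.
rewrite inE => /andP[BA B2]; exists (Sub B B2); last by rewrite SubK.
by rewrite inE SubK.
Qed.

Lemma adj_edges G u v : u != v -> adj G u v = (edges_in [set u; v] \subset G).
Proof.
move=> uv; have uv2 : #|[set u; v]| == 2%N by rewrite cards2 uv.
apply/exists_inP/subsetP => [[e eG /eqP ve] e'|h].
  rewrite inE => e's; suff -> : e' = e by [].
  by apply/val_inj/eqP; rewrite /= eqEcard ve e's (eqP uv2) (eqP (valP e')).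
exists (Sub [set u; v] uv2); last by rewrite SubK.
by apply: h; rewrite inE SubK.
Qed.

Lemma adj_irr G : irreflexive (adj G).
Proof.
move=> u; apply/negbTE/exists_inP => -[e _ /eqP ve].
by have := valP e; rewrite ve setUid cards1.
Qed.

Lemma adj_sym G : symmetric (adj G).
Proof. by move=> u v; rewrite /adj setUC. Qed.

Lemma adj_neq G u v : adj G u v -> u != v.
Proof. by apply: contraTneq => ->; rewrite adj_irr. Qed.

Lemma adj_setU F G u v : (forall e, e \in F -> val e != [set u; v]) ->
  adj (F :|: G) u v = adj G u v.
Proof.
move=> Fuv; apply/exists_inP/exists_inP => -[e eG ve].
  by exists e => //; move: eG; rewrite inE => /orP[/Fuv|//]; rewrite ve.
by exists e => //; rewrite inE eG orbT.
Qed.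

Lemma clique_edges G A : clique (adj G) A = (edges_in A \subset G).
Proof.
apply/cliqueP/subsetP => [cA e|h u v uA vA uv].
  rewrite inE => eA; have /cards2P[u [v [uv ve]]] : #|val e| == 2%N := valP e.
  have : adj G u v.
    by apply: cA => //; apply: (subsetP eA); rewrite ve !inE eqxx ?orbT.
  by rewrite adj_edges // => /subsetP/(_ e); apply; rewrite inE ve.
rewrite adj_edges //; apply/subsetP => e; rewrite inE => ve.
apply: h; rewrite inE (subset_trans ve) //.
by apply/subsetP => w /set2P[]->.
Qed.

Definition edges_between S W : {set edge n} :=
  [set e : edge n | [exists u in S, exists w in W, val e == [set u; w]]].

Lemma card_edges_between S W : (#|edges_between S W| <= #|S| * #|W|)%N.
Proof.
rewrite -cardsX -(card_imset _ val_inj).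
apply: leq_trans (leq_imset_card (fun q : 'I_n * 'I_n => [set q.1; q.2]) _).
apply/subset_leq_card/subsetP => B /imsetP[e].
rewrite inE => /exists_inP[u uS /exists_inP[w wW /eqP ve]] ->.
by apply/imsetP; exists (u, w) => //; rewrite inE uS wW.
Qed.

(** Disjointness makes the map from pairs [(u, w)] to edges injective, so no edge is counted from
    both ends. *)
Lemma sum_degree_edges_between G S W : [disjoint S & W] ->
  (\sum_(w in W) #|[set u in S | adj G u w]|
   <= #|G :&: edges_between S W|)%N.
Proof.
move=> dSW.
pose P := [set q : 'I_n * 'I_n | [&& q.1 \in S, q.2 \in W & adj G q.1 q.2]].
have notSW x : x \in S -> x \in W -> False.
  by move=> xS xW; have /pred0P/(_ x) := dSW; rewrite /= xS xW.
have -> : (\sum_(w in W) #|[set u in S | adj G u w]| = #|P|)%N.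
  rewrite -sum1_card (partition_big (fun q => q.2) (fun w => w \in W)) /=.
    apply: eq_bigr => w wW; rewrite -sum1_card.
    rewrite (reindex_onto (fun u => (u, w)) (fun q => q.1)) /=.
      by apply: eq_bigl => u; rewrite !inE !eqxx /= wW /= !andbT.
    by move=> [u w'] /= /andP[_ /eqP ->].
  by move=> q; rewrite inE => /and3P[].
have inj : {in P &, injective (fun q => [set q.1; q.2])}.
  move=> [u w] [u' w'] /=; rewrite !inE /= => /and3P[uS wW _] /and3P[u'S w'W _] E.
  have /set2P[->|uw'] : u \in [set u'; w'] by rewrite -E !inE eqxx.
    have /set2P[wu|->//] : w \in [set u'; w'] by rewrite -E !inE eqxx orbT.
    by case: (notSW u') => //; rewrite -wu.
  by case: (notSW u) => //; rewrite uw'.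
rewrite -(card_in_imset inj) -[leqRHS](card_imset _ val_inj).
apply/subset_leq_card/subsetP => B /imsetP[[u w]].
rewrite inE /= => /and3P[uS wW /exists_inP[e eG /eqP ve]] ->.
apply/imsetP; exists e => //; rewrite !inE eG /=.
by apply/exists_inP; exists u => //; apply/exists_inP; exists w => //; apply/eqP.
Qed.

Definition degree G v : nat := #|[set u | adj G u v]|.

Lemma degree_edges_between G v :
  (degree G v <= #|G :&: edges_between [set~ v] [set v]|)%N.
Proof.
have := @sum_degree_edges_between G [set~ v] [set v]; rewrite big_set1.
rewrite -setI_eq0 setIC setICr eqxx => /(_ isT); apply: leq_trans.
apply/subset_leq_card/subsetP => u; rewrite !inE => uv.
by rewrite uv andbT (adj_neq uv).
Qed.

End EdgeSets.

(** * Maximum degree, dominating sets and extension of edges to triangles *)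

Section UpperBounds.
Variables (R : realType) (n : nat) (p : R).
Hypothesis p01 : 0 <= p <= 1.
Implicit Types (G F : {set edge n}) (B C U : {set 'I_n}) (u v w : 'I_n).

Lemma gnp_probE (A : pred (graph n)) : gnp_prob p A = prob p A.
Proof.
rewrite /gnp_prob /prob /expect big_mkcond; apply: eq_bigr => G _.
by case: ifP => AG; rewrite ?mulr1 ?mulr0.
Qed.

Lemma prob_degree_tail (D : R) :
  prob p (fun G => [exists v : 'I_n, D <= (degree G v)%:R])
  <= n%:R * expR (3 * p * n%:R - D).
Proof.
have [p0 p1] := andP p01.
apply: le_trans (prob_union p01 xpredT _) _.
rewrite mulr_natl -[X in _ *+ X]card_ord -sumr_const; apply: ler_sum => v _.
apply: (@le_trans _ _
  (prob p (fun G => D <= #|G :&: edges_between [set~ v] [set v]|%:R))).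
  by apply: le_prob => // G /le_trans; apply; rewrite ler_nat degree_edges_between.
apply: le_trans (prob_tail p01 _ _) _; rewrite ler_expR lerB // ler_wpM2l ?mulr_ge0 //.
rewrite ler_nat (leq_trans (card_edges_between _ _)) // cards1 muln1.
by rewrite (leq_trans (max_card _)) ?card_ord.
Qed.

Lemma chi_c_le_degree G d : (forall v, (degree G v <= d)%N) -> (chi_c G <= d.+1)%N.
Proof.
move=> Gd; have [c hc] := greedy_colouring Gd.
have cne u v : adj G u v -> (u < v)%N -> c u != c v.
  by move=> uv ltuv; apply: hc => //; rewrite inE.
rewrite -[d.+1]card_ord; apply: (@clique_chromatic_number_le _ _ _ c).
apply: clique_colouring_edge => u v uv.
have := adj_neq uv; rewrite -val_eqE neq_ltn => /orP[lt|lt]; first exact: cne.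
by rewrite eq_sym; apply: cne => //; rewrite adj_sym.
Qed.

(** By symmetry the first [k] vertices may serve as the dominating set. The pairs joining a fixed
    [v] to them are distinct edges; [k.-1] allows for [v] being one of them. *)
Lemma prob_not_dominating k : (k <= n)%N ->
  prob p (fun G => [exists v, [forall w : 'I_n, (w < k)%N ==> ~~ adj G v w]])
  <= n%:R * expR (- ((k.-1)%:R * p)).
Proof.
move=> kn; have [p0 p1] := andP p01.
apply: le_trans (prob_union p01 xpredT _) _.
rewrite mulr_natl -[X in _ *+ X]card_ord -sumr_const; apply: ler_sum => v _.
pose K : {set 'I_n} := [set w : 'I_n | (w < k)%N] :\ v.
pose F w := edges_in [set v; w].
have cF w : w \in enum K -> #|F w| = 1%N.
  by rewrite mem_enum !inE => /andP[wv _]; rewrite card_edges_in cards2 eq_sym wv.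
have dF : {in enum K &, forall w w', w != w' -> [disjoint F w & F w']}.
  move=> w w'; rewrite !mem_enum !inE => /andP[wv _] /andP[w'v _] ww'.
  rewrite -setI_eq0 edges_inI -cards_eq0 card_edges_in.
  have -> : [set v; w] :&: [set v; w'] = [set v].
    apply/setP => x; rewrite !inE; have [->//|xv/=] := eqVneq x v.
    by have [->|//] := eqVneq x w; rewrite (negbTE ww').
  by rewrite cards1.
apply: (@le_trans _ _ (prob p (fun G => all (fun w => ~~ (F w \subset G)) (enum K)))).
  apply: le_prob => // G /forallP h; apply/allP => w.
  rewrite mem_enum !inE => /andP[wv wk].
  by rewrite -adj_edges 1?eq_sym //; apply: (implyP (h w)).
apply: le_trans (prob_avoid_disjoint p01 (enum_uniq _) dF) _.
rewrite ler_expR lerN2 (eq_big_seq (fun=> p)) => [|w wK]; last by rewrite cF.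
rewrite big_const_seq count_predT iter_addr_0 -[p *+ _]mulr_natl ler_wpM2r // ler_nat.
rewrite -cardE.
have := cardsD1 v [set w : 'I_n | (w < k)%N]; rewrite -/K.
have -> : #|[set w : 'I_n | (w < k)%N]| = k.
  have inj : injective (widen_ord kn) by move=> i j /(congr1 val) /= /val_inj.
  rewrite -[RHS]card_ord -(card_imset 'I_k inj).
  apply: eq_card => w; rewrite inE.
  apply/idP/imsetP => [wk|[i _ ->]]; last exact: ltn_ord i.
  by exists (Ordinal wk) => //; apply: val_inj.
by move=> ->; case: (v \in [set w : 'I_n | (w < k)%N]) => //=; apply: leq_pred.
Qed.

Lemma chi_c_le_dominating G k :
    (forall v, [exists w : 'I_n, (w < k)%N && adj G v w]) -> (k <= n)%N ->
  (chi_c G <= k)%N.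
Proof.
move=> dom kn; pose d v := xchoose (existsP (dom v)).
have dE v : (d v < k)%N && adj G v (d v) := xchooseP (existsP (dom v)).
have dk v : (d v < k)%N by case/andP: (dE v).
rewrite -[k]card_ord.
apply: (@clique_chromatic_number_le _ _ _ (fun v => Ordinal (dk v))).
apply: (@clique_colouring_dominated _ _ (@adj_sym _ G) (@adj_irr _ G) _ _
          (widen_ord kn)) => v.
have /andP[_] := dE v; congr (adj G v _); exact: val_inj.
Qed.

(** For fixed [u] and [v], the paths of length two through the other [n - 2] vertices are
    edge-disjoint, and each is present with probability [p ^+ 2]. *)
Lemma prob_edge_not_extended :
  prob p (fun G => [exists (q : 'I_n * 'I_n | q.1 != q.2),
                     [forall w, ~~ (adj G q.1 w && adj G q.2 w)]])
  <= n%:R ^+ 2 * expR (- ((n - 2)%:R * p ^+ 2)).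
Proof.
have [p0 p1] := andP p01.
apply: le_trans (prob_union p01 _ _) _.
apply: (@le_trans _ _ (\sum_(q : 'I_n * 'I_n) expR (- ((n - 2)%:R * p ^+ 2)))).
  rewrite [leLHS]big_mkcond; apply: ler_sum => -[u v] _ /=.
  case: ifPn => uv; last by rewrite expR_ge0.
  pose F w := edges_in [set u; w] :|: edges_in [set v; w].
  pose K : {set 'I_n} := ~: [set u; v].
  have KE w : w \in enum K -> (u != w) && (v != w).
    by rewrite mem_enum !inE negb_or ![w == _]eq_sym.
  have cF w : w \in enum K -> #|F w| = 2%N.
    move=> /KE/andP[uw vw]; rewrite cardsU edges_inI !card_edges_in !cards2 uw vw.
    have -> : [set u; w] :&: [set v; w] = [set w].
      apply/setP => x; rewrite !inE; have [->|xw] := eqVneq x w; first by rewrite !orbT.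
      by rewrite !orbF; apply/andP => -[/eqP-> /eqP uv']; case/eqP: uv.
    by rewrite cards1.
  have dF : {in enum K &, forall w w', w != w' -> [disjoint F w & F w']}.
    move=> w w' /KE/andP[uw vw] /KE/andP[uw' vw'] ww'.
    apply/pred0P => e /=; rewrite !inE; apply/negP => /andP[h h'].
    have mem x y : val e \subset [set x; y] -> y \in val e.
      move=> exy; suff -> : val e = [set x; y] by rewrite !inE eqxx orbT.
      apply/eqP; rewrite eqEcard exy (eqP (valP e)) cards2.
      by case: (x != y).
    have we : w \in val e by case/orP: h => /mem.
    by case/orP: h' => /subsetP/(_ w we)/set2P[] wE;
      move: uw vw ww'; rewrite wE ?eqxx.
  apply: (@le_trans _ _ (prob p (fun G => all (fun w => ~~ (F w \subset G)) (enum K)))).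
    apply: le_prob => // G /forallP h; apply/allP => w /KE/andP[uw vw].
    by rewrite subUset -!adj_edges.
  apply: le_trans (prob_avoid_disjoint p01 (enum_uniq _) dF) _.
  rewrite ler_expR lerN2 (eq_big_seq (fun=> p ^+ 2)) => [|w wK]; last by rewrite cF.
  rewrite big_const_seq count_predT iter_addr_0 -[p ^+ 2 *+ _]mulr_natl.
  rewrite ler_wpM2r ?exprn_ge0 // ler_nat -cardE cardsCs setCK cards2 uv.
  by rewrite card_ord.
by rewrite sumr_const card_prod card_ord -[leLHS]mulr_natl natrM -expr2.
Qed.

End UpperBounds.

(** * Colouring without monochromatic triangles, block by block *)

Section TriangleColouring.
Variable n : nat.
Implicit Types (G F : {set edge n}) (B C U : {set 'I_n}) (u v w : 'I_n).

(* [link_matching G B v j U]: the neighbourhood of [v] contains [j] pairwise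
   disjoint edges within [B :\: U]. *)
Fixpoint link_matching G B v j U : bool :=
  if j is j'.+1 then
    [exists q : 'I_n * 'I_n,
      [&& [&& q.1 \in B :\: U, q.2 \in B :\: U,
              adj G v q.1, adj G v q.2 & adj G q.1 q.2]
        & link_matching G B v j' (U :|: [set q.1; q.2])]]
  else true.

(** The matching only queries pairs formed by [v] and vertices outside [U], and every edge of [F]
    has an endpoint in [U] other than [v]. *)
Lemma link_matching_setU F G B v j U :
    (forall e, e \in F -> exists a, [/\ a \in val e, a \in U & a != v]) ->
  link_matching (F :|: G) B v j U = link_matching G B v j U.
Proof.
elim: j U => //= j IH U FU.
have adjFG x y : (x == v) || (x \notin U) -> (y == v) || (y \notin U) ->
    adj (F :|: G) x y = adj G x y.
  move=> xU yU; apply: adj_setU => e /FU[a [ae aU av]].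
  apply: contraTneq ae => ->; rewrite !inE negb_or.
  by apply/andP; split; apply/eqP => aE; [move: xU | move: yU];
    rewrite -aE (negbTE av) aU.
apply: eq_existsb => -[u w] /=.
have [/setDP[_ uU]|//] := boolP (u \in B :\: U).
have [/setDP[_ wU]|//] := boolP (w \in B :\: U).
rewrite !adjFG ?eqxx ?uU ?wU ?orbT // IH // => e /FU[a [ae aU av]].
by exists a; rewrite inE aU.
Qed.

(** There are at most |B|^2 choices for the first matching edge, and its triangle with [v] costs
    [p ^+ 3]. Conditioning on that triangle does not affect the rest of the matching, because the
    two endpoints have moved into [U]. *)
Lemma prob_link_matching (R : realType) (p : R) B v j U : 0 <= p <= 1 ->
  prob p (fun G => link_matching G B v j U) <= (#|B|%:R ^+ 2 * p ^+ 3) ^+ j.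
Proof.
move=> p01; have [p0 p1] := andP p01.
elim: j U => [|j IH] U /=; first by rewrite expr0 prob_le1.
apply: le_trans (prob_union p01 xpredT _) _.
apply: (@le_trans _ _ (\sum_(q in setX B B) p ^+ 3 * (#|B|%:R ^+ 2 * p ^+ 3) ^+ j)).
  rewrite [leRHS]big_mkcond; apply: ler_sum => -[u w] _; rewrite in_setX /=.
  have [/and4P[uB wB vu /andP[vw uw]]|h] :=
    boolP [&& u \in B, w \in B, v != u, v != w & u != w].
    rewrite uB wB /=.
    pose F := edges_in [set v; u; w].
    have F3 : #|F| = 3%N.
      rewrite card_edges_in -setUA cardsU1 cards2 uw !inE negb_or vu vw.
      by [].
    apply: (@le_trans _ _ (expect p (fun G => (F \subset G)%:R *
        (link_matching G B v j (U :|: [set u; w]))%:R))).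
      apply: le_expect => // G; rewrite -natrM mulnb ler_nat.
      case: (link_matching _ _ _ _ _); rewrite ?andbF ?andbT //.
      have [/and5P[_ _ avu avw auw]|//] := boolP [&& _, _, _, _ & _].
      suff -> : F \subset G by [].
      rewrite -clique_edges; apply/cliqueP => x y; rewrite !inE -!orbA.
      move=> /or3P[]/eqP-> /or3P[]/eqP->; rewrite ?eqxx //;
        by [move=> _; rewrite // adj_sym].
    rewrite (expect_sub p F (fun G => (link_matching G B v j (U :|: [set u; w]))%:R)) F3.
    rewrite ler_wpM2l ?exprn_ge0 //; apply: le_trans (IH (U :|: [set u; w])).
    apply: le_expect => // G; rewrite link_matching_setU // => e.
    rewrite inE => eF; have /cards2P[x [y [xy ve]]] : #|val e| == 2%N := valP e.
    have [a ae av] : exists2 a, a \in val e & a != v.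
      have [xv|xv] := eqVneq x v; last by exists x; rewrite // ve !inE eqxx.
      by exists y; rewrite ?ve ?inE ?eqxx ?orbT // -xv eq_sym.
    exists a; split => //; have := subsetP eF a ae.
    by rewrite !inE (negbTE av) /= => ->; rewrite orbT.
  rewrite /prob /expect big1 => [|G _].
    by case: ifP => // _; rewrite !mulr_ge0 ?exprn_ge0 ?mulr_ge0 ?exprn_ge0.
  have [/andP[/and5P[/setDP[uB _] /setDP[wB _] avu avw auw] _]|_] := boolP (_ && _).
    by case/negP: h; rewrite uB wB (adj_neq avu) (adj_neq avw) (adj_neq auw).
  by rewrite mulr0.
rewrite sumr_const cardsX -[leLHS]mulr_natl natrM -expr2 [leRHS]exprS.
by rewrite mulrA.
Qed.

(** The endpoints of a greedily built maximal matching cover every edge of the link. *)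
Lemma link_matching_cover G B v j U : ~~ link_matching G B v j U ->
  exists C : {set 'I_n}, (#|C| <= j.*2)%N /\ forall u w, u \in B :\: U -> w \in B :\: U ->
    adj G v u -> adj G v w -> adj G u w -> (u \in C) || (w \in C).
Proof.
elim: j U => [|j IH] U //= nm.
have [/existsP[[u w] /= huw]|h] := boolP [exists q : 'I_n * 'I_n,
    [&& q.1 \in B :\: U, q.2 \in B :\: U,
        adj G v q.1, adj G v q.2 & adj G q.1 q.2]]; last first.
  exists set0; rewrite cards0; split=> // u w uB wB vu vw uw; case/negP: h.
  by apply/existsP; exists (u, w); rewrite /= uB wB vu vw uw.
have /IH[C [Cj hC]] : ~~ link_matching G B v j (U :|: [set u; w]).
  by move: nm; rewrite negb_exists => /forallP/(_ (u, w)); rewrite /= huw.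
exists (C :|: [set u; w]); split.
  rewrite doubleS (leq_trans (leq_card_setU _ _)) // -addn2 leq_add //.
  by rewrite cards2; case: (u != w).
move=> x y xB yB vx vy xy.
have [xuw|xuw] := boolP (x \in [set u; w]); first by rewrite inE xuw orbT.
have [yuw|yuw] := boolP (y \in [set u; w]); first by rewrite !inE -!in_set2 yuw !orbT.
have /orP[xC|yC] : (x \in C) || (y \in C); last 2 first.
- by rewrite inE xC.
- by rewrite [y \in _]inE yC orbT.
apply: hC => //; rewrite in_setD in_setU negb_or ?xuw ?yuw andbT.
  by move: xB; rewrite inE => /andP[-> ->].
by move: yB; rewrite inE => /andP[-> ->].
Qed.

Definition block s v : {set 'I_n} := [set u : 'I_n | u %/ s == v %/ s]%N.

Lemma card_block s v : (0 < s)%N -> (#|block s v| <= s)%N.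
Proof.
move=> s0; pose g (u : 'I_n) : 'I_s := Ordinal (ltn_pmod u s0).
have inj : {in block s v &, injective g}.
  move=> u w; rewrite !inE => /eqP uv /eqP wv /(congr1 val) /= uw.
  by apply: val_inj; rewrite /= (divn_eq u s) (divn_eq w s) uv wv uw.
by rewrite -(card_in_imset inj) (leq_trans (max_card _)) // card_ord.
Qed.

(** A colour is a block number together with a greedy colour, so a monochromatic triangle lies in
    one block. There the cover of its largest vertex [z] contains one of the other two, whose greedy
    colour [z] avoided. *)
Lemma chi_c_le_blocks G s m :
    (forall u v, adj G u v -> exists w, adj G u w && adj G v w) ->
    (forall v, ~~ link_matching G (block s v) v m set0) ->
  (chi_c G <= (n %/ s).+1 * m.*2.+1)%N.
Proof.
move=> ext nm.
have [C hC] := choice (fun v => link_matching_cover (nm v)).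
have CE v : (#|C v| <= m.*2)%N by case: (hC v).
have CC v := proj2 (hC v).
have [c hc] := greedy_colouring CE.
have ltb (v : 'I_n) : (v %/ s < (n %/ s).+1)%N.
  by rewrite ltnS leq_div2r // ltnW.
pose c' v := (Ordinal (ltb v), c v).
have last_triangle (x y z : 'I_n) : (x < z)%N -> (y < z)%N -> adj G z x -> adj G z y ->
    adj G x y -> c' z = c' x -> c' z = c' y -> False.
  move=> xz yz zx zy xy [bx cx] [by_ cy].
  have /orP[xC|yC] : (x \in C z) || (y \in C z).
    by apply: (CC z) => //; rewrite /block !inE /= -?bx -?by_ eqxx.
  - by have := hc x z xC xz; rewrite cx eqxx.
  - by have := hc y z yC yz; rewrite cy eqxx.
have -> : ((n %/ s).+1 * m.*2.+1 = #|{: 'I_(n %/ s).+1 * 'I_(m.*2.+1)}|)%N.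
  by rewrite card_prod !card_ord.
apply: (@clique_chromatic_number_le _ _ _ c').
apply: (clique_colouring_triangle (@adj_sym _ G) (@adj_irr _ G) ext).
move=> u v w uv uw vw cuv cuw.
have := adj_neq uv; have := adj_neq uw; have := adj_neq vw.
rewrite -!val_eqE !neq_ltn /= => vw' uw' uv'.
have : [|| (v < u) && (w < u), (u < v) && (w < v) | (u < w) && (v < w)]%N by lia.
have [vu wu wv] : [/\ adj G v u, adj G w u & adj G w v].
  by split; rewrite adj_sym.
case/or3P => /andP[lt1 lt2].
- exact: (@last_triangle v w u).
- by apply: (@last_triangle u w v); rewrite // -cuv.
- by apply: (@last_triangle u v w); rewrite // -cuw.
Qed.

End TriangleColouring.

(** * Lower bound for G(n,p) *)

Section LowerBound.
Variables (R : realType) (n : nat) (p : R).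
Hypothesis p01 : 0 <= p <= 1.
Implicit Types (G F : {set edge n}) (Q S W J : {set 'I_n}) (u v w : 'I_n).

Let p0 : 0 <= p. Proof. by case/andP: p01. Qed.

Definition covered G S k : {set {set 'I_n}} :=
  [set Q : {set 'I_n} | [&& Q \subset S, #|Q| == k &
    [exists w, (w \notin S) && [forall u in Q, adj G u w]]]].

Definition all_cliques_covered G S k : bool :=
  [forall Q : {set 'I_n},
    [&& Q \subset S, #|Q| == k & clique (adj G) Q] ==> (Q \in covered G S k)].

(** Some colour class contains [s] vertices, and a [k]-clique inside it must have a common neighbour
    outside the chosen set. *)
Lemma chi_c_small_covered G k s : (1 < k)%N -> (0 < s)%N -> (0 < n)%N ->
    (chi_c G * s <= n)%N ->
  exists2 S : {set 'I_n}, #|S| = s & all_cliques_covered G S k.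
Proof.
move=> k1 s0 n0 chin.
have [c cc] := clique_chromatic_number_colouring (adj G).
have [|||i [S [Ss cS]]] := @pigeonhole_class _ _ s c; rewrite ?card_ord //.
exists S => //; apply/forallP => Q; apply/implyP => /and3P[QS /eqP Qk cQ].
have [|w wS wQ] := clique_colouring_covered (@adj_sym _ G) cc cS QS _ cQ.
  by rewrite Qk.
rewrite inE QS Qk eqxx /=; apply/existsP; exists w; rewrite wS.
exact/forall_inP.
Qed.

Definition degree_in G S w : nat := #|[set u in S | adj G u w]|.

Lemma leq_bin_exp a b : ('C(a, b) <= a ^ b)%N.
Proof.
apply: (@leq_trans ('C(a, b) * b`!)); first by rewrite leq_pmulr ?fact_gt0.
rewrite bin_ffact ffact_prod -[X in (_ <= _ ^ X)%N]card_ord -prod_nat_const.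
by apply: leq_prod => i _; apply: leq_subr.
Qed.

Lemma card_covered G S k :
  (#|covered G S k| <= \sum_(w | w \notin S) degree_in G S w ^ k)%N.
Proof.
pose D w := [set Q : {set 'I_n} | Q \subset [set u in S | adj G u w] & #|Q| == k].
apply: (@leq_trans #|\bigcup_(w | w \notin S) D w|).
  apply/subset_leq_card/subsetP => Q.
  rewrite inE => /and3P[QS Qk /existsP[w /andP[wS /forall_inP wQ]]].
  apply/bigcupP; exists w => //; rewrite inE Qk andbT.
  by apply/subsetP => u uQ; rewrite inE (subsetP QS) ?wQ.
apply: leq_trans (_ : (\sum_(w | w \notin S) #|D w| <= _)%N); last first.
  by apply: leq_sum => w _; rewrite cards_draws leq_bin_exp.
apply: (big_ind2 (fun (A : {set {set 'I_n}}) m => #|A| <= m)%N) => //.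
  by rewrite cards0.
move=> A a B b Aa Bb.
by rewrite (leq_trans (leq_card_setU _ _)) // leq_add.
Qed.

(** The vertices outside [S] are split at degree [d] into [S]. Those below contribute at most
    [d ^+ k.+1] each; for those above, [k] factors are bounded by the maximum degree [D] and the
    remaining one is summed to [M]. *)
Lemma card_covered_le G S k (D M d : R) : 0 <= d -> 0 <= D ->
    (forall w, (degree_in G S w)%:R <= D) ->
    (\sum_(w in [set w | (w \notin S) && (d <= (degree_in G S w)%:R)])
        degree_in G S w)%:R <= M ->
  #|covered G S k.+1|%:R <= n%:R * d ^+ k.+1 + D ^+ k * M.
Proof.
move=> d0 D0 hD hM.
apply: (@le_trans _ _ (\sum_(w | w \notin S) (degree_in G S w ^ k.+1)%N%:R)).
  by rewrite -natr_sum ler_nat card_covered.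
rewrite (bigID (fun w => d <= (degree_in G S w)%:R)) /= addrC lerD //.
  apply: (@le_trans _ _ (\sum_(w : 'I_n) d ^+ k.+1)).
    rewrite big_mkcond; apply: ler_sum => w _; case: ifP => [/andP[_]|_].
      rewrite -ltNge natrX => dw; rewrite lerXn2r // ?nnegrE ?ler0n //.
      exact: ltW.
    exact: exprn_ge0.
  by rewrite sumr_const card_ord mulr_natl.
apply: (@le_trans _ _ (D ^+ k * (\sum_(w in [set w | (w \notin S)
    && (d <= (degree_in G S w)%:R)]) degree_in G S w)%:R)).
  rewrite natr_sum mulr_sumr (eq_bigl _ _ (fun w => in_set _ w)).
  apply: ler_sum => w _; rewrite natrX exprSr ler_wpM2r //.
  by rewrite lerXn2r // ?nnegrE ?ler0n.
by rewrite ler_wpM2l ?exprn_ge0.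
Qed.

(* The tail bound is applied at the average of the two thresholds. *)
Lemma prob_dense_cut s (d L : R) : 1 <= L -> 8 * (s%:R * p * L) <= d ->
    1 <= s%:R * p ->
  prob p (fun G => [exists S : {set 'I_n}, (#|S| == s) &&
    [exists W : {set 'I_n}, (d * #|W|%:R <= #|G :&: edges_between S W|%:R) &&
      (s%:R * L <= #|G :&: edges_between S W|%:R)]])
  <= n%:R ^+ s * expR (n%:R * expR (- (L / 2)) - s%:R * L / 2).
Proof.
move=> L1 dE sp1.
apply: (@le_trans _ _ (\sum_(S : {set 'I_n} | #|S| == s)
    expR (n%:R * expR (- (L / 2)) - s%:R * L / 2))); last first.
  rewrite (eq_bigl (fun S => S \in [set S : {set 'I_n} | #|S| == s])) => [|S];
    last by rewrite inE.
  rewrite sumr_const card_draws card_ord -[leLHS]mulr_natl ler_wpM2r ?expR_ge0 //.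
  by rewrite -natrX ler_nat leq_bin_exp.
apply: le_trans (prob_union p01 _ _) _; apply: ler_sum => S /eqP Ss.
apply: (le_trans (prob_union p01 xpredT _)).
(* The bound decays by exp(-L/2) for each vertex of [W], so the sum over all [W] is the product (1 +
   exp(-L/2))^n. *)
apply: (@le_trans _ _ (\sum_(W : {set 'I_n})
    expR (- (s%:R * L / 2)) * \prod_(w : 'I_n) (if w \in W then expR (- (L / 2)) else 1))).
  apply: ler_sum => W _; rewrite -big_mkcond /= big_const iter_mulr_1.
  rewrite -expRM_natl -expRD.
  apply: (@le_trans _ _ (prob p (fun G => (d * #|W|%:R + s%:R * L) / 2 <=
      #|G :&: edges_between S W|%:R))).
    by apply: le_prob => // G /andP[]; lra.
  apply: le_trans (prob_tail p01 _ _) _; rewrite ler_expR.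
  have : (#|edges_between S W|%:R : R) <= s%:R * #|W|%:R.
    by rewrite -natrM ler_nat -Ss card_edges_between.
  have : 0 <= (#|W|%:R : R) by [].
  set r := #|W|%:R; set b := _%:R => r0 bE.
  have h1 : p * b <= p * (s%:R * r) by rewrite ler_wpM2l.
  have h2 : 8 * (s%:R * p * L) * r <= d * r by rewrite ler_wpM2r.
  have h3 : s%:R * p * r <= s%:R * p * r * L.
    by rewrite ler_peMr // mulr_ge0 // (le_trans _ sp1).
  have h4 : L * r <= s%:R * p * (L * r).
    by rewrite ler_peMl // mulr_ge0 // (le_trans _ L1).
  have h5 : 0 <= L * r by rewrite mulr_ge0 // (le_trans _ L1).
  lra.
rewrite -mulr_sumr expRD mulrC ler_wpM2r ?expR_ge0 //.
rewrite -bigA_distr.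
apply: (@le_trans _ _ (\prod_(w < n) expR (expR (- (L / 2))))).
  by apply: ler_prod => w _; rewrite addr_ge0 ?expR_ge0 //= addrC expR_ge1Dx.
by rewrite big_const iter_mulr_1 card_ord -expRM_natl.
Qed.

End LowerBound.

(** * First moment and correlations of cliques inside a vertex set *)

Section CliqueCounting.
Variables (R : realType) (n : nat) (p : R).
Hypothesis p01 : 0 <= p <= 1.
Implicit Types (G F : {set edge n}) (Q S J : {set 'I_n}).

Let p0 : 0 <= p. Proof. by case/andP: p01. Qed.
Let p1 : p <= 1. Proof. by case/andP: p01. Qed.

Lemma card_supersets S J k : (#|J| <= k)%N ->
  (#|[set Q : {set 'I_n} | [&& Q \subset S, #|Q| == k & J \subset Q]]|
   <= #|S| ^ (k - #|J|))%N.
Proof.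
move=> Jk; set X := [set _ | _].
have inj : {in X &, injective (fun Q => Q :\: J)}.
  move=> Q Q'; rewrite !inE => /and3P[_ _ JQ] /and3P[_ _ JQ'] QQ'.
  by rewrite -(setID Q J) -(setID Q' J) QQ' (setIidPr JQ) (setIidPr JQ').
rewrite -(card_in_imset inj); apply: leq_trans (leq_bin_exp _ _).
rewrite -cards_draws; apply/subset_leq_card/subsetP => A /imsetP[Q].
rewrite !inE => /and3P[QS /eqP Qk JQ] ->.
by rewrite (subset_trans (subsetDl _ _)) // cardsDS // Qk eqxx.
Qed.

(** The square of the right-hand side is s^2 (s^2 p^j)^(j-1), and s^2 p^j >= s^2 p^k >= L^2 >= 1. *)
Lemma expected_cliques_ge s L k j : 1 <= s -> 1 <= L ->
    L ^+ 2 <= s ^+ 2 * p ^+ k -> (1 < j <= k)%N ->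
  s * L <= s ^+ j * p ^+ 'C(j, 2).
Proof.
move=> s1 L1 spk /andP[j1 jk].
have s0 : 0 <= s by rewrite (le_trans _ s1).
have L0 : 0 <= L by rewrite (le_trans _ L1).
rewrite -(@ler_pXn2r _ 2) ?nnegrE ?mulr_ge0 ?exprn_ge0 //.
have -> : (s ^+ j * p ^+ 'C(j, 2)) ^+ 2 = s ^+ 2 * (s ^+ 2 * p ^+ j) ^+ j.-1.
  rewrite exprMn -!exprM exprMn -!exprM mulrA -exprD; congr (_ ^+ _ * _ ^+ _).
    by case: j j1 {jk} => // j _; rewrite /=; lia.
  by rewrite -[X in (_ * X)%N]/(2`!) bin_ffact ffactnS ffactn1.
rewrite exprMn ler_wpM2l ?exprn_ge0 //.
have h1 : L ^+ 2 <= s ^+ 2 * p ^+ j.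
  apply: le_trans spk _; rewrite ler_wpM2l ?exprn_ge0 //.
  by rewrite ler_wiXn2l.
have L21 : 1 <= L ^+ 2 by rewrite exprn_ege1.
apply: (le_trans h1); rewrite -[leLHS]expr1 ler_weXn2l //; last by lia.
exact: le_trans h1.
Qed.

(** Pairs sharing an edge are grouped by their intersection [J], for which there are at most 2^k
    choices inside [Q]. A given [J] contributes at most s^(k-|J|) p^(2c - C(|J|,2)), and
    [expected_cliques_ge] for j = |J| supplies the missing factor. *)
Lemma janson_cov_cliques S k (L : R) (r : seq {set 'I_n}) :
    uniq r -> {subset r <= [set Q : {set 'I_n} | Q \subset S & #|Q| == k]} ->
    1 <= L -> 1 <= #|S|%:R :> R -> L ^+ 2 <= #|S|%:R ^+ 2 * p ^+ k ->
  janson_cov p (@edges_in n) r * (#|S|%:R * L)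
  <= 2 ^+ k * (#|S|%:R ^+ k * p ^+ 'C(k, 2)) ^+ 2.
Proof.
move=> ur rS L1 s1 spk; set s := #|S|%:R in s1 spk *.
pose c := 'C(k, 2).
have s0 : 0 <= s by [].
have sizer : (size r)%:R <= s ^+ k.
  rewrite -natrX ler_nat (leq_trans _ (leq_bin_exp _ _)) // -cards_draws.
  by rewrite -(card_uniqP ur); apply/subset_leq_card/subsetP.
have one Q : Q \in r ->
    (\sum_(Q' <- r | (Q' != Q) && ~~ [disjoint edges_in Q & edges_in Q'])
       p ^+ #|edges_in Q :|: edges_in Q'|) * (s * L)
    <= 2 ^+ k * (s ^+ k * p ^+ (c + c)).
  move=> /rS; rewrite inE => /andP[QS /eqP Qk].
  apply: (@le_trans _ _ ((\sum_(Q' in [set Q' : {set 'I_n} |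
      [&& Q' \subset S, #|Q'| == k & (1 < #|Q :&: Q'|)%N]])
     p ^+ (c + c - 'C(#|Q :&: Q'|, 2))) * (s * L))).
    rewrite ler_wpM2r ?mulr_ge0 ?(le_trans _ L1) //.
    rewrite -big_filter big_uniq ?filter_uniq //= [leLHS]big_mkcond [leRHS]big_mkcond.
    apply: ler_sum => Q' _; rewrite mem_filter inE.
    have [/rS|] := boolP (Q' \in r); last first.
      by rewrite andbF; case: ifP => // _; rewrite exprn_ge0.
    rewrite inE andbT => /andP[-> /eqP Q'k].
    rewrite -setI_eq0 edges_inI -cards_eq0 card_edges_in -lt0n bin_gt0 Q'k eqxx /=.
    case: (1 < _)%N; rewrite ?andbF // andbT.
    case: ifP => _; last by rewrite exprn_ge0.
    by rewrite cardsU edges_inI !card_edges_in Qk Q'k.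
  rewrite (partition_big (fun Q' => Q :&: Q') (fun J => J \in powerset Q)) /=; last first.
    by move=> Q' _; rewrite powersetE subsetIl.
  rewrite mulr_suml.
  have -> : 2 ^+ k = #|powerset Q|%:R :> R by rewrite card_powerset Qk natrX.
  rewrite mulr_natl -sumr_const; apply: ler_sum => J; rewrite powersetE => JQ.
  have Jk : (#|J| <= k)%N by rewrite -Qk subset_leq_card.
  have [J1|J1] := ltnP 1 #|J|; last first.
    rewrite big_pred0 ?mul0r ?mulr_ge0 ?exprn_ge0 // => Q'.
    rewrite inE; apply/negP => /andP[/and3P[_ _ QQ'] /eqP JE].
    by move: J1; rewrite -JE leqNgt QQ'.
  apply: (@le_trans _ _ (s ^+ (k - #|J|) * p ^+ (c + c - 'C(#|J|, 2)) * (s * L))).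
    rewrite ler_wpM2r ?mulr_ge0 ?(le_trans _ L1) //.
    rewrite (eq_bigr (fun=> p ^+ (c + c - 'C(#|J|, 2)))) => [|Q' /andP[_ /eqP->]//].
    apply: (@le_trans _ _ (\sum_(Q' in [set Q' : {set 'I_n} |
        [&& Q' \subset S, #|Q'| == k & J \subset Q']]) p ^+ (c + c - 'C(#|J|, 2)))).
      rewrite [leLHS]big_mkcond [leRHS]big_mkcond; apply: ler_sum => Q' _.
      have [/andP[]|_] := boolP (_ && _); last by case: ifP => // _; rewrite exprn_ge0.
      rewrite !inE => /and3P[-> -> _] /eqP <-.
      by rewrite subsetIr.
    rewrite sumr_const -[leLHS]mulr_natl ler_wpM2r ?exprn_ge0 //.
    by rewrite -natrX ler_nat card_supersets.
  apply: (@le_trans _ _ (s ^+ (k - #|J|) * p ^+ (c + c - 'C(#|J|, 2))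
                         * (s ^+ #|J| * p ^+ 'C(#|J|, 2)))).
    rewrite ler_wpM2l ?mulr_ge0 ?exprn_ge0 //.
    by apply: (expected_cliques_ge s1 L1 spk); rewrite J1.
  rewrite mulrACA -!exprD subnK // subnK // (leq_trans (leq_bin2l 2 Jk)) //.
  by rewrite leq_addr.
rewrite /janson_cov mulr_suml big_seq.
apply: (@le_trans _ _ (\sum_(Q <- r | Q \in r) 2 ^+ k * (s ^+ k * p ^+ (c + c)))).
  by apply: ler_sum => Q; apply: one.
rewrite -big_seq big_const_seq count_predT iter_addr_0 -[leLHS]mulr_natl.
have -> : (s ^+ k * p ^+ c) ^+ 2 = s ^+ k * (s ^+ k * p ^+ (c + c)).
  by rewrite exprD; ring.
by rewrite mulrCA ler_wpM2l ?exprn_ge0 // ler_wpM2r ?mulr_ge0 ?exprn_ge0.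
Qed.

End CliqueCounting.

(** Every factor of the falling factorial is at least s/2. *)
Lemma expn_le_binomial s k : (k.*2 <= s)%N -> (s ^ k <= 'C(s, k) * (2 ^ k * k`!))%N.
Proof.
move=> ks; rewrite mulnCA bin_ffact ffact_prod -[X in (_ ^ X <= _)%N]card_ord.
rewrite -[X in (_ <= 2 ^ X * _)%N]card_ord -!prod_nat_const -big_split /=.
by apply: leq_prod => i _; have := ltn_ord i; lia.
Qed.

Definition binomial_const k : nat := 2 ^ k * k`!.

(** * Janson's inequality for the uncovered cliques *)

Section LowerBoundProbability.
Variables (R : realType) (n : nat) (p : R).
Hypothesis p01 : 0 <= p <= 1.
Implicit Types (G F : {set edge n}) (Q S W J : {set 'I_n}) (u v w : 'I_n).

Let p0 : 0 <= p. Proof. by case/andP: p01. Qed.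

(** Being covered is decided by pairs with an endpoint outside [S]; this expresses the independence
    from the edges inside [S]. *)
Lemma covered_setU G Q S k : Q \subset S ->
  covered (edges_in Q :|: G) S k = covered G S k.
Proof.
move=> QS; apply/setP => A; rewrite !inE.
apply: andb_id2l => AS; apply: andb_id2l => _.
apply: eq_existsb => w; apply: andb_id2l => wS.
apply: eq_forallb_in => u uA; apply: adj_setU => e.
rewrite inE => eQ; apply: contraNneq wS => ve.
by apply: (subsetP QS); apply: (subsetP eQ); rewrite ve !inE eqxx orbT.
Qed.

(* Sum over the possible values [C] of the family of covered sets: the event
   [covered G S k = C] does not depend on the pairs inside [S]. *)
Lemma prob_all_cliques_covered S k (L : R) :
    (k.*2 <= #|S|)%N -> 1 <= L -> 1 <= #|S|%:R :> R ->
    L ^+ 2 <= #|S|%:R ^+ 2 * p ^+ k -> (1 < k)%N ->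
  prob p (fun G => ((#|covered G S k|).*2 <= 'C(#|S|, k))%N
                   && all_cliques_covered G S k)
  <= expR (- (#|S|%:R * L / (2 ^+ (k + 4) * (binomial_const k)%:R ^+ 2))).
Proof.
move=> kS L1 s1 spk k1.
set s : R := #|S|%:R; pose b : R := (binomial_const k)%:R.
set bound := expR _.
pose fam (C : {set {set 'I_n}}) := enum [set Q : {set 'I_n} |
  (Q \subset S) && (#|Q| == k) && (Q \notin C)].
pose good (C : {set {set 'I_n}}) := (#|C|.*2 <= 'C(#|S|, k))%N.
have famS C : {subset fam C <= [set Q : {set 'I_n} | Q \subset S & #|Q| == k]}.
  by move=> Q; rewrite mem_enum !inE => /andP[].
have b1 : 1 <= b by rewrite ler1n muln_gt0 expn_gt0 fact_gt0.
have b0 : 0 < b := lt_le_trans ltr01 b1.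
pose M := s ^+ k * p ^+ 'C(k, 2).
have sL0 : 0 < s * L by rewrite mulr_gt0 // (lt_le_trans ltr01).
have sLM : s * L <= M.
  by apply: (expected_cliques_ge p01 s1 L1 spk); rewrite k1 leqnn.
have M0 : 0 < M := lt_le_trans sL0 sLM.
(* The first moment is at least M/(2b) and the correlation term at most 2^k M^2/(sL). This [t] makes
   the linear term at least twice the bound [X] on the quadratic term, leaving [X] in the
   exponent. *)
pose t := s * L / (M * (2 ^+ (k + 2) * b)).
have k2 : 1 <= 2 ^+ k :> R by rewrite exprn_ege1 // ler1n.
have t01 : 0 <= t <= 1.
  rewrite /t exprD; apply/andP; split.
    by rewrite divr_ge0 ?(ltW sL0) // mulr_ge0 ?(ltW M0) // !mulr_ge0 ?exprn_ge0 // ltW.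
  rewrite ler_pdivrMr ?mul1r; last first.
    by rewrite mulr_gt0 // mulr_gt0 // mulr_gt0 ?exprn_gt0.
  rewrite (le_trans sLM) // ler_peMr ?(ltW M0) //.
  by nra.
have step C : good C ->
  expect p (fun G => (covered G S k == C)%:R *
     (all (fun Q => ~~ (edges_in Q \subset G)) (fam C))%:R)
  <= expect p (fun G => (covered G S k == C)%:R) * bound.
  move=> gC; apply: le_trans (janson_avoid p01 t01 (enum_uniq _) _ _) _.
  - by move=> G; rewrite ler0n.
  - by move=> Q G /famS; rewrite inE => /andP[QS _] /=; rewrite covered_setU.
  rewrite ler_wpM2l ?expect_ge0 // ler_expR.
  have cov := janson_cov_cliques p01 (enum_uniq _) (@famS C) L1 s1 spk.
  rewrite -/(fam C) -/s -/M in cov *.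
  set J := janson_cov _ _ _ in cov *.
  (* At least half of the [k]-subsets of [S] lie outside a good [C]. *)
  have mu : M <= 2 * b * \sum_(Q <- fam C) p ^+ #|edges_in Q|.
    rewrite (eq_big_seq (fun=> p ^+ 'C(k, 2))) => [|Q /famS]; last first.
      by rewrite inE card_edges_in => /andP[_ /eqP ->].
    rewrite big_const_seq count_predT iter_addr_0 -[p ^+ _ *+ _]mulr_natl mulrA.
    rewrite ler_wpM2r ?exprn_ge0 // /s /b -natrX -!natrM ler_nat.
    apply: leq_trans (expn_le_binomial kS) _; rewrite [leqRHS]mulnAC leq_mul2r -cardE.
    apply/orP; right.
    have := cardsID C [set Q : {set 'I_n} | Q \subset S & #|Q| == k].
    rewrite cards_draws; set X := #|_ :&: _|; set Y := #|_ :\: _|.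
    have XC : (X <= #|C|)%N by apply/subset_leq_card/subsetIr.
    have -> : #|[set Q : {set 'I_n} | (Q \subset S) && (#|Q| == k) && (Q \notin C)]| = Y.
      by apply: eq_card => Q; rewrite !inE andbC.
    by move: gC XC; rewrite /good; clear; lia.
  set m := \sum_(Q <- _) _ in mu *.
  have b_neq0 : b != 0 by rewrite gt_eqF.
  have M_neq0 : M != 0 by rewrite gt_eqF.
  have k_neq0 : 2 ^+ k != 0 :> R by rewrite gt_eqF ?exprn_gt0.
  pose X := s * L / (2 ^+ (k + 4) * b ^+ 2).
  have tm : X * 2 <= t * m.
    have -> : X * 2 = t * (M / (2 * b)).
      by rewrite /X /t !exprD; field; rewrite b_neq0 M_neq0 k_neq0.
    rewrite ler_wpM2l //; first by case/andP: t01.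
    by rewrite ler_pdivrMr ?mulr_gt0 // mulrC.
  have tJ : t ^+ 2 * J <= X.
    have -> : t ^+ 2 * J = J * (s * L) * (s * L / (M ^+ 2 * (2 ^+ (k + 2) * b) ^+ 2)).
      by rewrite /t !exprD; field; rewrite b_neq0 M_neq0 k_neq0.
    have -> : X = 2 ^+ k * M ^+ 2 * (s * L / (M ^+ 2 * (2 ^+ (k + 2) * b) ^+ 2)).
      by rewrite /X !exprD; field; rewrite b_neq0 M_neq0 k_neq0.
    rewrite ler_wpM2r // divr_ge0 ?(ltW sL0) //.
    by rewrite mulr_ge0 // ?exprn_ge0 // ?mulr_ge0 ?exprn_ge0 // ltW.
  by rewrite -/X; lra.
apply: (@le_trans _ _ (expect p (fun G => \sum_(C : {set {set 'I_n}} | good C)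
  (covered G S k == C)%:R *
     (all (fun Q => ~~ (edges_in Q \subset G)) (fam C))%:R))).
  apply: le_expect => // G.
  have [/andP[gG /forallP cG]|_] := boolP (_ && _); last first.
    by apply: sumr_ge0 => C _; rewrite mulr_ge0.
  rewrite (bigD1 (covered G S k)) //= eqxx mul1r.
  have -> : all (fun Q => ~~ (edges_in Q \subset G)) (fam (covered G S k)).
    apply/allP => Q; rewrite mem_enum inE => /andP[/andP[QS Qk]].
    rewrite -clique_edges; apply: contra => cQ.
    by apply: (implyP (cG Q)); rewrite QS Qk.
  by rewrite lerDl sumr_ge0 // => C _; rewrite mulr_ge0.
rewrite expect_sum; apply: (@le_trans _ _ (\sum_(C : {set {set 'I_n}} | good C)
  expect p (fun G => (covered G S k == C)%:R) * bound)).
  by apply: ler_sum => C; apply: step.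
(* The events [covered G S k == C] are disjoint, so their probabilities sum to at most 1. *)
rewrite -mulr_suml -[leRHS]mul1r ler_wpM2r ?expR_ge0 //.
rewrite -expect_sum -[leRHS](expect1 (edge n) p); apply: le_expect => // G.
have [gG|gG] := boolP (good (covered G S k)).
  rewrite (bigD1 (covered G S k)) //= eqxx big1 ?addr0 // => C /andP[_].
  by rewrite eq_sym => /negbTE ->.
rewrite big1 // => C gC; have [E|//] := eqVneq (covered G S k) C.
by rewrite E gC in gG.
Qed.
End LowerBoundProbability.

(* The first summand makes Janson's bound beat the [n ^ s] choices of [S]; the
   second keeps at least half of the [k]-subsets of [S] uncovered. *)
Definition lower_const k : nat :=
  (2 ^ (k + 5) * binomial_const k ^ 2 + 2 * (8 ^ k + 1) * binomial_const k)%N.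

Lemma binomial_const_gt0 k : (0 < binomial_const k)%N.
Proof. by rewrite muln_gt0 expn_gt0 fact_gt0. Qed.

Lemma lower_const_gt k : (k.*2 + 4 <= lower_const k)%N.
Proof.
apply: leq_trans (leq_addl _ _).
apply: leq_trans (leq_pmulr _ (binomial_const_gt0 k)).
by have := @ltn_expl 8 k isT; lia.
Qed.

(** After multiplication by [L], the first summand is at most 8^k s^k because n p^k L^(k+1) <= 1,
    and the second at most s^k because n p L^3 <= s. As [L] exceeds a suitable constant, this leaves
    at most half of the [k]-subsets. *)
Lemma few_covered (R : realType) n (p : R) (G : {set edge n}) (S : {set 'I_n}) k L :
    (1 < k)%N -> 0 <= p -> (k.*2 <= #|S|)%N -> 1 <= L ->
    (2 * (8 ^ k + 1) * binomial_const k)%:R <= L ->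
    n%:R * p ^+ k * L ^+ k.+1 <= 1 -> n%:R * p * L ^+ 3 <= #|S|%:R ->
    (#|covered G S k|%:R : R) <= n%:R * (8 * (#|S|%:R * p * L)) ^+ k
       + (n%:R * p * L) ^+ k.-1 * (#|S|%:R * L) ->
  (#|covered G S k|.*2 <= 'C(#|S|, k))%N.
Proof.
case: k => // k k1 p0 kS L1 LK npk npL.
set s : R := #|S|%:R in npL *; set c := #|covered _ _ _|.
rewrite [k.+1.-1]/= => cE.
have L0 : 0 < L := lt_le_trans ltr01 L1.
have s0 : 0 <= s by [].
pose b : R := (binomial_const k.+1)%:R.
have b0 : 0 < b by rewrite ltr0n binomial_const_gt0.
have npL0 : 0 <= n%:R * p * L by rewrite !mulr_ge0 // ltW.
have h1 : n%:R * (8 * (s * p * L)) ^+ k.+1 * L <= 8 ^+ k.+1 * s ^+ k.+1.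
  have -> : n%:R * (8 * (s * p * L)) ^+ k.+1 * L
      = (8 ^+ k.+1 * s ^+ k.+1) * (n%:R * p ^+ k.+1 * L ^+ k.+2).
    by rewrite !exprMn [L ^+ k.+2]exprS; ring.
  by rewrite ler_piMr // mulr_ge0 // exprn_ge0.
have h2 : (n%:R * p * L) ^+ k * (s * L) * L <= s ^+ k.+1.
  have -> : (n%:R * p * L) ^+ k * (s * L) * L = s * ((n%:R * p * L) ^+ k * L ^+ 2) by ring.
  rewrite [leRHS]exprS ler_wpM2l //.
  apply: (@le_trans _ _ ((n%:R * p * L ^+ 3) ^+ k)); last first.
    by rewrite lerXn2r // nnegrE // mulr_ge0 ?exprn_ge0 ?mulr_ge0 // ltW.
  have -> : n%:R * p * L ^+ 3 = (n%:R * p * L) * L ^+ 2 by ring.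
  rewrite [leRHS]exprMn ler_wpM2l ?exprn_ge0 // -[leLHS]expr1 ler_weXn2l //.
  by rewrite exprn_ege1.
have h3 : c%:R * L <= (8 ^+ k.+1 + 1) * s ^+ k.+1.
  apply: (@le_trans _ _ ((n%:R * (8 * (s * p * L)) ^+ k.+1
                          + (n%:R * p * L) ^+ k * (s * L)) * L)).
    by rewrite ler_wpM2r // ltW.
  by rewrite mulrDl [leRHS]mulrDl mul1r lerD.
have h4 : s ^+ k.+1 <= 'C(#|S|, k.+1)%:R * b.
  by rewrite /s /b -natrX -natrM ler_nat expn_le_binomial.
have LK' : 2 * (8 ^+ k.+1 + 1) * b <= L.
  by apply: le_trans LK; rewrite natrM natrM natrD natrX.
have h5 : c%:R * (2 * (8 ^+ k.+1 + 1) * b) <= (8 ^+ k.+1 + 1) * ('C(#|S|, k.+1)%:R * b).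
  apply: (@le_trans _ _ (c%:R * L)); first by rewrite ler_wpM2l.
  by apply: (le_trans h3); rewrite ler_wpM2l // addr_ge0 ?exprn_ge0.
have e0 : 0 < (8 ^+ k.+1 + 1) * b :> R by rewrite mulr_gt0 // ltr_wpDl ?exprn_ge0.
rewrite -(ler_nat R) -mul2n natrM -(ler_pM2r e0).
by move: h5; set y := 8 ^+ k.+1 + 1; lra.
Qed.

(** Three bad events, each of probability at most 1/n: a vertex of large degree ([E1]), a set of
    size [s] with an overly dense cut ([E2]), and a set with few covered [k]-sets all of whose
    [k]-cliques are covered ([E3]). *)
Lemma prob_chi_c_small (R : realType) n k s (p L : R) :
    0 <= p <= 1 -> (1 < k)%N -> (0 < n)%N ->
    (lower_const k)%:R * (ln n%:R + 1) <= L -> 1 <= p * n%:R ->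
    n%:R * p ^+ k * L ^+ k.+1 <= 1 -> n%:R * p * L ^+ 3 <= s%:R ->
    L ^+ 2 <= s%:R ^+ 2 * p ^+ k ->
  prob p (fun G : graph n => (chi_c G * s <= n)%N) <= 3 / n%:R.
Proof.
move=> p01 k1 n0 LK pn1 npk npL spk.
have [p0 p1] := andP p01.
pose l : R := ln n%:R; rewrite -/l in LK.
have nE : n%:R = expR l by rewrite lnK // posrE ltr0n.
have l0 : 0 <= l by rewrite ln_ge0 // ler1n.
have K4 : (k.*2 + 4)%:R <= (lower_const k)%:R :> R by rewrite ler_nat lower_const_gt.
have LK4 : (k.*2 + 4)%:R * (l + 1) <= L.
  by apply: le_trans LK; rewrite ler_wpM2r // addr_ge0.
have k20 : 0 <= k.*2%:R :> R by [].
have L4 : 4 * (l + 1) <= L.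
  by apply: le_trans LK4; rewrite ler_wpM2r ?addr_ge0 // natrD lerDr.
have L1 : 1 <= L by lra.
have L0 : 0 <= L by lra.
have sL : L <= s%:R.
  apply: le_trans npL; rewrite [n%:R * p]mulrC exprS mulrCA ler_peMr //.
  by rewrite mulr_ege1 // exprn_ege1.
have s1 : 1 <= s%:R :> R := le_trans L1 sL.
have s0 : (0 < s)%N by rewrite -(ltr_nat R); lra.
have kL : k.*2%:R <= L.
  apply: le_trans LK4; rewrite natrD; nra.
have ks : (k.*2 <= s)%N by rewrite -(ler_nat R) (le_trans kL).
have sp1 : 1 <= s%:R * p.
  have : 1 <= (s%:R * p) ^+ 2.
    apply: (@le_trans _ _ (L ^+ 2)); first by rewrite exprn_ege1.
    apply: (le_trans spk); rewrite exprMn ler_wpM2l ?exprn_ge0 //.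
    by rewrite ler_wiXn2l.
  by rewrite -{1}(expr1n R 2) ler_pXn2r ?nnegrE ?mulr_ge0.
pose E1 (G : graph n) := [exists v : 'I_n, n%:R * p * L <= (degree G v)%:R].
pose E2 (G : graph n) := [exists S : {set 'I_n}, (#|S| == s) &&
    [exists W : {set 'I_n},
      (8 * (s%:R * p * L) * #|W|%:R <= #|G :&: edges_between S W|%:R) &&
      (s%:R * L <= #|G :&: edges_between S W|%:R)]].
pose E3 (G : graph n) := [exists (S : {set 'I_n} | #|S| == s),
   ((#|covered G S k|).*2 <= 'C(#|S|, k))%N && all_cliques_covered G S k].
apply: (@le_trans _ _ (prob p (fun G => (E1 G || E2 G) || E3 G))).
  apply: le_prob => // G chiG.
  have [S Ss bS] := chi_c_small_covered k1 s0 n0 chiG.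
  have [//|/existsPn nE1] := boolP (E1 G).
  have [//|nE2] := boolP (E2 G).
  apply/exists_inP; exists S; first exact/eqP.
  rewrite bS andbT.
  have LK3 : (2 * (8 ^ k + 1) * binomial_const k)%:R <= L.
    apply: le_trans LK; rewrite -[leLHS]mulr1 ler_pM // ?ler_nat ?leq_addl //.
    by rewrite lerDr.
  apply: (few_covered (p := p) k1 p0 _ L1 LK3 npk); rewrite Ss //.
  have [k' kE] : exists k', k = k'.+1 by case: (k) k1 => // k'; exists k'.
  rewrite [in leLHS]kE [X in _ * (_) ^+ X]kE.
  (* If the vertices of [W] had total degree above [s L] into [S], then [W] would meet both
     thresholds of [E2]. *)
  pose W := [set w | (w \notin S) && (8 * (s%:R * p * L) <= (degree_in G S w)%:R)].
  have cut : (\sum_(w in W) degree_in G S w <= #|G :&: edges_between S W|)%N.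
    apply: sum_degree_edges_between; apply/pred0P => w; rewrite /= inE.
    by case: (w \in S).
  have d0 : 0 <= 8 * (s%:R * p * L) by rewrite !mulr_ge0.
  rewrite kE; apply: card_covered_le => //.
  - by rewrite !mulr_ge0.
  - move=> w; apply: (@le_trans _ _ (degree G w)%:R).
      rewrite ler_nat; apply/subset_leq_card/subsetP => u.
      by rewrite !inE => /andP[_]; rewrite adj_sym.
    by have := nE1 w; rewrite -ltNge => /ltW.
  rewrite -/W; rewrite leNgt; apply/negP => big.
  move/negP: nE2; apply; apply/existsP; exists S; rewrite Ss eqxx /=.
  apply/existsP; exists W; apply/andP; split; last first.
    by apply: (le_trans (ltW big)); rewrite ler_nat.
  apply: (@le_trans _ _ (\sum_(w in W) degree_in G S w)%:R); last by rewrite ler_nat.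
  rewrite natr_sum mulr_natr -sumr_const; apply: ler_sum => w.
  by rewrite inE => /andP[].
have invn : expR (- l) = n%:R^-1 by rewrite expRN nE.
have nX : n%:R ^+ s = expR (s%:R * l) by rewrite nE -expRM_natl.
apply: le_trans (prob_or p01 _ _) _.
have -> : 3 / n%:R = (n%:R^-1 + n%:R^-1) + n%:R^-1 :> R by lra.
apply: lerD; first apply: le_trans (prob_or p01 _ _) _; first apply: lerD.
- apply: le_trans (prob_degree_tail n p01 (n%:R * p * L)) _.
  rewrite -invn {1}nE -expRD ler_expR.
  have : (p * n%:R) * (L - 3) >= L - 3 by rewrite ler_peMl //; lra.
  lra.
- apply: le_trans (prob_dense_cut n p01 L1 (lexx _) sp1) _.
  rewrite nX -expRD -invn ler_expR.
  have : n%:R * expR (- (L / 2)) <= 1.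
    by rewrite nE -expRD -[leRHS]expR0 ler_expR; lra.
  have : s%:R * (L / 2 - l) >= 1 * (L / 2 - l) by rewrite ler_wpM2r //; lra.
  lra.
apply: le_trans (prob_union p01 _ _) _.
pose bk : R := 2 ^+ (k + 4) * (binomial_const k)%:R ^+ 2.
have bk0 : 0 < bk by rewrite mulr_gt0 // exprn_gt0 // ltr0n binomial_const_gt0.
apply: (@le_trans _ _ (\sum_(S : {set 'I_n} | #|S| == s) expR (- (s%:R * L / bk)))).
  apply: ler_sum => S /eqP Ss.
  have -> : s%:R = #|S|%:R :> R by rewrite Ss.
  by apply: prob_all_cliques_covered; rewrite // Ss.
rewrite (eq_bigl (fun S => S \in [set S : {set 'I_n} | #|S| == s])) => [|S];
  last by rewrite inE.
rewrite sumr_const card_draws card_ord -[leLHS]mulr_natl.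
apply: (@le_trans _ _ (n%:R ^+ s * expR (- (s%:R * L / bk)))).
  by rewrite ler_wpM2r ?expR_ge0 // -natrX ler_nat leq_bin_exp.
rewrite nX -expRD -invn ler_expR.
(* Half of the Janson exponent pays for the n^s choices of [S]; the other half still gives 1/n. *)
have : 2 * l <= L / bk.
  rewrite ler_pdivlMr //; apply: le_trans LK.
  apply: (@le_trans _ _ ((2 ^ (k + 5) * binomial_const k ^ 2)%:R * l)).
    rewrite /bk natrM !natrX !exprD le_eqVlt; apply/orP; left; apply/eqP; ring.
  by rewrite ler_pM // ?ler_nat ?leq_addr // lerDl.
have -> : s%:R * L / bk = s%:R * (L / bk) by rewrite mulrA.
set y := L / bk => hy.
have : s%:R * (y - l) >= 1 * (y - l) by rewrite ler_wpM2r //; lra.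
lra.
Qed.

(** * Asymptotics *)

(** With l = ln n, any multiple of ln n + 1 is eventually below n^a. The proof squares exp(al/2) >=
    al/2. *)
Lemma expR_dominates (R : realType) (a K : R) : 0 < a ->
  exists l0, forall l, l0 <= l -> 0 <= l /\ K * (l + 1) <= expR (a * l).
Proof.
move=> a0; exists (8 * `|K| / a ^+ 2 + 1) => l hl.
have a20 : 0 < a ^+ 2 by rewrite exprn_gt0.
have q0 : 0 <= 8 * `|K| / a ^+ 2 by rewrite divr_ge0 ?mulr_ge0 // ltW.
have l1 : 1 <= l by lra.
have hK : 8 * `|K| <= l * a ^+ 2 by rewrite -ler_pdivrMr //; lra.
split; first by lra.
have KK := ler_norm K; have K0 := normr_ge0 K.
have -> : expR (a * l) = expR (a * l / 2) ^+ 2.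
  by rewrite expr2 -expRD; congr expR; lra.
have al0 : 0 <= a * l / 2 by rewrite divr_ge0 ?mulr_ge0 ?ltW //; lra.
have he : a * l / 2 <= expR (a * l / 2) by have := expR_ge1Dx (a * l / 2); lra.
apply: (@le_trans _ _ ((a * l / 2) ^+ 2)); last by rewrite lerXn2r // nnegrE expR_ge0.
have h1 : 8 * `|K| * l <= l * a ^+ 2 * l by rewrite ler_wpM2r //; lra.
have h2 : K * (l + 1) <= `|K| * (l + 1) by rewrite ler_wpM2r //; lra.
have h3 : `|K| * (l + 1) <= `|K| * (2 * l) by rewrite ler_wpM2l //; lra.
have -> : (a * l / 2) ^+ 2 = l * a ^+ 2 * l / 4 by field.
lra.
Qed.

(* [A n] fails with probability at most [3 / n] in [G(n, q)], uniformly in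
   [q = n ^ (x - 1 +- eta)] and [n] large. *)
Definition likely (R : realType) (x : R) (A : forall n, pred (graph n)) : Prop :=
  exists2 eta : R, 0 < eta & exists l0 : R, forall n (q : R), (0 < n)%N ->
    0 <= q <= 1 -> l0 <= ln n%:R ->
    expR ((x - 1 - eta) * ln n%:R) <= q <= expR ((x - 1 + eta) * ln n%:R) ->
  prob q (fun G => ~~ A n G) <= 3 / n%:R.

Section Asymptotics.
Variable R : realType.
Implicit Types (x y eps eta l q : R).

Lemma lnK_nat n : (0 < n)%N -> n%:R = expR (ln n%:R) :> R.
Proof. by move=> n0; rewrite lnK // posrE ltr0n. Qed.

Lemma ler_expRM a b l : 0 <= l -> a <= b -> expR (a * l) <= expR (b * l) :> R.
Proof. by move=> l0 ab; rewrite ler_expR ler_wpM2r. Qed.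

Lemma truncn_ge_half (t : R) : 2 <= t -> t / 2 <= (Num.truncn t)%:R.
Proof. by move=> t2; have := truncnS_gt t; rewrite -natr1; lra. Qed.

(** Here L = n^d with small d, and s is about n^(1-y+eps). In order, the conditions on the exponents
    say that n p^k << 1, that p^(-k/2) is at most n^(1-y), and that p n is at most n^(1-y), up to
    n^o(1). *)
Lemma likely_lower k x y eps : (1 < k)%N -> 0 < x -> 1 < (1 - x) * k%:R ->
    (1 - x) * k%:R <= 2 * (1 - y) -> y <= 1 - x -> 0 < eps ->
  likely x (fun n G => expR ((y - eps) * ln n%:R) <= (chi_c G)%:R).
Proof.
move=> k1 x0 xk1 xk2 yx eps0.
have k0 : 0 <= k%:R :> R by [].
(* [mm] is the least of the available slacks, and [d] is small enough that all error terms together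
   stay below it. *)
pose mm := Num.min eps (Num.min ((1 - x) * k%:R - 1) x).
pose d := mm / (8 * (k%:R + 1)).
have mm0 : 0 < mm by rewrite !lt_min eps0 x0 subr_gt0 xk1.
have d0 : 0 < d by rewrite divr_gt0 // mulr_gt0 //; lra.
have dk : 8 * (d * (k%:R + 1)) = mm by rewrite /d; field; rewrite gt_eqF //; lra.
have [m1 m2 m3] : [/\ mm <= eps, mm <= (1 - x) * k%:R - 1 & mm <= x].
  by split; rewrite /mm !ge_min lexx ?orbT.
have dk0 : 0 <= d * k%:R by rewrite mulr_ge0 // ltW.
exists d => //.
have [l1 h1] := expR_dominates (lower_const k)%:R d0.
have [l2 h2] := expR_dominates 2 (divr_gt0 eps0 (ltr0n R 2)).
exists (Num.max l1 l2) => n q n0 q01; rewrite ge_max => /andP[/h1[l0 K1] /h2[_ K2]].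
set l := ln n%:R in l0 K1 K2 *; move=> /andP[ql qu].
have nE : n%:R = expR l by exact: lnK_nat.
have q0 : 0 <= q by case/andP: q01.
pose s := Num.truncn (expR ((1 - y + eps) * l)).
have su : s%:R <= expR ((1 - y + eps) * l) by rewrite truncn_le expR_ge0.
have sl : expR ((1 - y + eps / 2) * l) <= s%:R.
  have : expR ((1 - y + eps) * l) / 2 <= s%:R.
    apply: truncn_ge_half; apply: (@le_trans _ _ (2 * (l + 1))); first by lra.
    by apply: (le_trans K2); apply: ler_expRM => //; lra.
  apply: le_trans; rewrite ler_pdivlMr //.
  have -> : (1 - y + eps) * l = (1 - y + eps / 2) * l + eps / 2 * l by field.
  rewrite expRD ler_wpM2l ?expR_ge0 // (le_trans _ K2) //; lra.
apply: (@le_trans _ _ (prob q (fun G : graph n => (chi_c G * s <= n)%N))).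
  apply: le_prob => // G; rewrite -ltNge => chil.
  rewrite -(ler_nat R) natrM nE.
  have -> : l = (y - eps) * l + (1 - y + eps) * l by ring.
  by rewrite expRD ler_pM // ltW.
apply: (@prob_chi_c_small R n k s q (expR (d * l))) => //.
- apply: (@le_trans _ _ (expR ((x - 1 - d) * l) * expR l)).
    rewrite -expRD -[leLHS]expR0 ler_expR.
    have -> : (x - 1 - d) * l + l = (x - d) * l by ring.
    by rewrite mulr_ge0 //; lra.
  by rewrite nE ler_wpM2r ?expR_ge0.
- apply: (@le_trans _ _ (expR l * expR ((x - 1 + d) * l) ^+ k * expR (d * l) ^+ k.+1)).
    rewrite nE ler_wpM2r ?exprn_ge0 ?expR_ge0 // ler_wpM2l ?expR_ge0 //.
    by rewrite lerXn2r // nnegrE ?expR_ge0.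
  rewrite -!expRM_natl -!expRD -[leRHS]expR0 ler_expR -natr1.
  have -> : l + k%:R * ((x - 1 + d) * l) + (k%:R + 1) * (d * l)
    = - ((((1 - x) * k%:R - 1) - d * k%:R - d * (k%:R + 1)) * l) by ring.
  by rewrite oppr_le0 mulr_ge0 //; lra.
- apply: le_trans sl.
  apply: (@le_trans _ _ (expR l * expR ((x - 1 + d) * l) * expR (d * l) ^+ 3)).
    by rewrite nE ler_wpM2r ?exprn_ge0 ?expR_ge0 // ler_wpM2l ?expR_ge0.
  rewrite -!expRM_natl -!expRD.
  have -> : l + (x - 1 + d) * l + 3 * (d * l) = (x + 4 * d) * l by ring.
  by apply: ler_expRM => //; lra.
apply: (@le_trans _ _ (expR ((1 - y + eps / 2) * l) ^+ 2 * expR ((x - 1 - d) * l) ^+ k)).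
  rewrite -!expRM_natl -!expRD.
  have -> : 2 * ((1 - y + eps / 2) * l) + k%:R * ((x - 1 - d) * l)
     = (2 * (1 - y) - (1 - x) * k%:R + eps - d * k%:R) * l by field.
  have -> : 2 * (d * l) = (2 * d) * l by ring.
  by apply: ler_expRM => //; lra.
rewrite ler_pM // ?exprn_ge0 ?expR_ge0 //; rewrite lerXn2r // nnegrE ?expR_ge0 //.
Qed.

Lemma likely_upper_degree x eps : 0 < x -> 0 < eps ->
  likely x (fun n G => (chi_c G)%:R <= expR ((x + eps) * ln n%:R)).
Proof.
move=> x0 eps0; exists (eps / 4); first by rewrite divr_gt0.
have [l1 h1] := expR_dominates 5 (divr_gt0 eps0 (ltr0n R 4)).
exists l1 => n q n0 q01 /h1[l0 K1].
set l := ln n%:R in l0 K1 *; move=> /andP[ql qu].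
have nE : n%:R = expR l by exact: lnK_nat.
have D1 : 1 <= expR ((x + eps / 4) * l).
  by rewrite -[leLHS]expR0 ler_expR mulr_ge0 //; lra.
have DE : expR ((x + eps / 2) * l) = expR ((x + eps / 4) * l) * expR (eps / 4 * l).
  by rewrite -expRD; congr expR; field.
apply: (@le_trans _ _ (prob q (fun G : graph n =>
    [exists v : 'I_n, expR ((x + eps / 2) * l) <= (degree G v)%:R]))).
  apply: le_prob => // G; rewrite -ltNge => chil.
  apply/existsP; apply: contrapT => h.
  have hd v : (degree G v <= Num.truncn (expR ((x + eps / 2) * l)))%N.
    rewrite truncn_ge_nat ?expR_ge0 // leNgt; apply/negP => hv.
    by apply: h; exists v; apply: ltW.
  have := chi_c_le_degree hd; rewrite -(ler_nat R) => chid.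
  have tD : (Num.truncn (expR ((x + eps / 2) * l)))%:R <= expR ((x + eps / 2) * l).
    by rewrite truncn_le expR_ge0.
  move: chil; rewrite ltNge => /negP; apply; apply: (le_trans chid).
  rewrite -natr1.
  have -> : expR ((x + eps) * l)
      = expR ((x + eps / 2) * l) * expR (eps / 4 * l) * expR (eps / 4 * l).
    by rewrite -!expRD; congr expR; field.
  have e5 : 5 <= expR (eps / 4 * l) by lra.
  have D2 : 1 <= expR ((x + eps / 2) * l) by rewrite DE mulr_ege1 //; lra.
  have : 1 * 5 <= expR ((x + eps / 2) * l) * expR (eps / 4 * l) by rewrite ler_pM.
  have : expR ((x + eps / 2) * l) * 5 <= expR ((x + eps / 2) * l) * expR (eps / 4 * l).
    by rewrite ler_wpM2l ?expR_ge0.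
  have : expR ((x + eps / 2) * l) * expR (eps / 4 * l) * 1 <=
     expR ((x + eps / 2) * l) * expR (eps / 4 * l) * expR (eps / 4 * l).
    by rewrite ler_wpM2l ?mulr_ge0 ?expR_ge0 //; lra.
  lra.
apply: le_trans (prob_degree_tail n q01 _) _.
have -> : 3 / n%:R = 3 * expR (- l) :> R by rewrite expRN nE.
apply: (@le_trans _ _ (expR (- l))); last by rewrite ler_peMl ?expR_ge0 //; lra.
rewrite {1}nE -expRD ler_expR.
have qn : q * n%:R <= expR ((x + eps / 4) * l).
  have -> : (x + eps / 4) * l = (x - 1 + eps / 4) * l + l by ring.
  by rewrite expRD nE ler_wpM2r ?expR_ge0.
have : 1 * (expR (eps / 4 * l) - 3)
    <= expR ((x + eps / 4) * l) * (expR (eps / 4 * l) - 3).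
  by rewrite ler_wpM2r //; lra.
rewrite DE; lra.
Qed.

(** About n^(1-x+eps) vertices are used for domination, so a vertex expects at least n^(eps/4)
    neighbours among them; [eps <= x] keeps their number within [n]. *)
Lemma likely_upper_dominating x eps : x < 1 -> 0 < eps -> eps <= x ->
  likely x (fun n G => (chi_c G)%:R <= expR ((1 - x + eps) * ln n%:R)).
Proof.
move=> x1 eps0 epsx; exists (eps / 4); first by rewrite divr_gt0.
have [l1 h1] := expR_dominates 6 (divr_gt0 eps0 (ltr0n R 4)).
exists l1 => n q n0 q01 /h1[l0 K1].
set l := ln n%:R in l0 K1 *; move=> /andP[ql qu].
have nE : n%:R = expR l by exact: lnK_nat.
pose k := Num.truncn (expR ((1 - x + eps) * l)).
have ku : k%:R <= expR ((1 - x + eps) * l) by rewrite truncn_le expR_ge0.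
have kn : (k <= n)%N.
  rewrite -(ler_nat R) (le_trans ku) // nE ler_expR.
  by rewrite -[leRHS]mul1r ler_wpM2r //; lra.
apply: (@le_trans _ _ (prob q (fun G : graph n =>
   [exists v, [forall w : 'I_n, (w < k)%N ==> ~~ adj G v w]]))).
  apply: le_prob => // G; apply: contraR => h.
  apply: le_trans ku; rewrite ler_nat; apply: chi_c_le_dominating => // v.
  move: h; rewrite negb_exists => /forallP/(_ v); rewrite negb_forall.
  move=> /existsP[w]; rewrite negb_imply negbK => hw; apply/existsP; by exists w.
apply: le_trans (prob_not_dominating q01 kn) _.
have -> : 3 / n%:R = 3 * expR (- l) :> R by rewrite expRN nE.
apply: (@le_trans _ _ (expR (- l))); last by rewrite ler_peMl ?expR_ge0 //; lra.
rewrite {1}nE -expRD ler_expR.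
have k2 : expR ((1 - x + eps) * l) - 2 <= k.-1%:R.
  have := truncnS_gt (expR ((1 - x + eps) * l)); rewrite -/k -natr1.
  have : k%:R - 1 <= k.-1%:R :> R by case: (k) => [|k'] /=; rewrite -?natr1; lra.
  lra.
have D1 : 1 <= expR ((1 - x + eps / 2) * l).
  by rewrite -[leLHS]expR0 ler_expR mulr_ge0 //; lra.
have DE : expR ((1 - x + eps) * l) =
    expR ((1 - x + eps / 2) * l) * expR (eps / 4 * l) * expR (eps / 4 * l).
  by rewrite -!expRD; congr expR; field.
have k3 : expR ((1 - x + eps / 2) * l) <= k.-1%:R.
  apply: le_trans k2; rewrite DE.
  set D := expR ((1 - x + eps / 2) * l) in D1 *; set e := expR (eps / 4 * l) in K1 *.
  have e6 : 6 <= e by lra.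
  have : D * 6 <= D * e by rewrite ler_wpM2l //; lra.
  have : D * e * 1 <= D * e * e by rewrite ler_wpM2l ?mulr_ge0 ?expR_ge0 //; lra.
  lra.
have : expR (eps / 4 * l) <= k.-1%:R * q.
  have -> : eps / 4 * l = (1 - x + eps / 2) * l + (x - 1 - eps / 4) * l by field.
  by rewrite expRD ler_pM ?expR_ge0.
lra.
Qed.

Lemma likely_upper_blocks x eps : 1 / 2 < x -> x < 1 -> 0 < eps ->
    eps < 3 * (1 - x) ->
  likely x (fun n G => (chi_c G)%:R <= expR ((1 + 3 * (x - 1) / 2 + eps) * ln n%:R)).
Proof.
move=> x12 x1 eps0 epsx.
pose e := eps / 2.
have e0 : 0 < e by rewrite divr_gt0.
(* The first bound keeps s^2 p^3 <= n^(-e); the second keeps n p^2 >= n^((2x-1)/2), so that every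
   edge lies in a triangle. *)
pose eta := Num.min (e / 3) ((2 * x - 1) / 4).
have eta0 : 0 < eta by rewrite lt_min !divr_gt0 //; lra.
have [eta1 eta2] : eta <= e / 3 /\ eta <= (2 * x - 1) / 4.
  by split; rewrite /eta !ge_min lexx ?orbT.
(* Blocks have size about n^a, slightly below p^(-3/2). *)
pose a := 3 * (1 - x) / 2 - e.
have a0 : 0 < a by rewrite /a /e; lra.
(* A link matching of size [m] then has probability at most n^(-2), which survives the union over
   vertices. *)
pose m := (Num.truncn (2 / e)).+1.
have me : 2 <= e * m%:R.
  by rewrite mulrC -ler_pdivrMr // ltW // truncnS_gt.
have c0 : 0 < (2 * x - 1) / 2 by lra.
exists eta => //.
have [l1 h1] := expR_dominates 6 c0.
have [l2 h2] := expR_dominates (3 * m.*2.+1%:R) e0.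
have [l3 h3] := expR_dominates 2 a0.
have [l4 h4] := expR_dominates 4 (ltr01 : 0 < 1 :> R).
exists (Num.max (Num.max l1 l2) (Num.max l3 l4)) => n q n0 q01.
rewrite !ge_max => /andP[/andP[/h1[l0 K1] /h2[_ K2]] /andP[/h3[_ K3] /h4[_ K4]]].
set l := ln n%:R in l0 K1 K2 K3 K4 *; move=> /andP[ql qu].
have nE : n%:R = expR l by exact: lnK_nat.
have q0 : 0 <= q by case/andP: q01.
have n4 : 4 <= n%:R :> R by rewrite nE; move: K4; rewrite mul1r; lra.
have n2 : (2 <= n)%N by rewrite -(ler_nat R) (le_trans _ n4) // ler_nat.
pose s := Num.truncn (expR (a * l)).
have su : s%:R <= expR (a * l) by rewrite truncn_le expR_ge0.
have sl : expR (a * l) / 2 <= s%:R by apply: truncn_ge_half; lra.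
have s0 : (0 < s)%N by rewrite -(ltr_nat R); lra.
pose E1 (G : graph n) := [exists (z : 'I_n * 'I_n | z.1 != z.2),
                     [forall w, ~~ (adj G z.1 w && adj G z.2 w)]].
pose E2 (G : graph n) := [exists v : 'I_n, link_matching G (block s v) v m set0].
apply: (@le_trans _ _ (prob q (fun G => E1 G || E2 G))).
  apply: le_prob => // G; apply: contraR; rewrite negb_or => /andP[nE1 nE2].
  have ext u v : adj G u v -> exists w, adj G u w && adj G v w.
    move=> uv; apply/existsP; apply: contraR nE1; rewrite negb_exists => h.
    by apply/exists_inP; exists (u, v); rewrite //= (adj_neq uv).
  have nm v : ~~ link_matching G (block s v) v m set0.
    by move: nE2; rewrite negb_exists => /forallP.
  have := chi_c_le_blocks ext nm; rewrite -(ler_nat R) natrM => /le_trans; apply.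
  have ns : (n %/ s)%:R <= 2 * expR ((1 - a) * l).
    have -> : (1 - a) * l = l - a * l by ring.
    rewrite expRB -nE mulrA ler_pdivlMr ?expR_gt0 //.
    have : (n %/ s)%:R * s%:R <= n%:R :> R by rewrite -natrM ler_nat leq_divM.
    have : (n %/ s)%:R * (expR (a * l) / 2) <= (n %/ s)%:R * s%:R by rewrite ler_wpM2l.
    lra.
  have a1 : 1 <= expR ((1 - a) * l).
    by rewrite -[leLHS]expR0 ler_expR mulr_ge0 // /a; lra.
  apply: (@le_trans _ _ (3 * expR ((1 - a) * l) * m.*2.+1%:R)).
    by rewrite ler_wpM2r // -natr1; lra.
  have -> : (1 + 3 * (x - 1) / 2 + eps) * l = (1 - a) * l + e * l.
    by rewrite /a /e; field.
  rewrite expRD mulrAC mulrC ler_wpM2l ?expR_ge0 // (le_trans _ K2) //.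
  rewrite ler_peMr ?lerDr // mulr_ge0 //; lra.
have invn : expR (- l) = n%:R^-1 by rewrite expRN nE.
apply: le_trans (prob_or q01 _ _) _.
apply: (@le_trans _ _ (n%:R^-1 + n%:R^-1)); last first.
  have : 0 <= n%:R^-1 :> R by rewrite invr_ge0.
  lra.
apply: lerD.
  apply: le_trans (prob_edge_not_extended n q01) _.
  rewrite -invn nE -expRM_natl -expRD ler_expR.
  have hn : n%:R / 2 <= (n - 2)%:R :> R by rewrite natrB //; lra.
  have hq : expR ((x - 1 - eta) * l) ^+ 2 <= q ^+ 2 by rewrite lerXn2r // nnegrE ?expR_ge0.
  have : n%:R / 2 * expR ((x - 1 - eta) * l) ^+ 2 <= (n - 2)%:R * q ^+ 2.
    by rewrite ler_pM // ?divr_ge0 // exprn_ge0 ?expR_ge0.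
  have : expR ((2 * x - 1) / 2 * l) <= n%:R * expR ((x - 1 - eta) * l) ^+ 2.
    rewrite nE -expRM_natl -expRD.
    have -> : l + 2 * ((x - 1 - eta) * l) = (2 * x - 1 - 2 * eta) * l by ring.
    by apply: ler_expRM => //; lra.
  lra.
apply: le_trans (prob_union q01 xpredT _) _.
apply: (@le_trans _ _ (\sum_(v : 'I_n) expR (- e * l) ^+ m)).
  apply: ler_sum => v _; apply: le_trans (prob_link_matching (block s v) v m _ q01) _.
  have bs : #|block s v|%:R <= expR (a * l).
    by apply: le_trans su; rewrite ler_nat card_block.
  rewrite lerXn2r // ?nnegrE ?expR_ge0 ?mulr_ge0 ?exprn_ge0 //.
  apply: (@le_trans _ _ (expR (a * l) ^+ 2 * expR ((x - 1 + eta) * l) ^+ 3)).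
    by rewrite ler_pM ?exprn_ge0 // lerXn2r // nnegrE ?expR_ge0.
  rewrite -!expRM_natl -expRD.
  have -> : 2 * (a * l) + 3 * ((x - 1 + eta) * l) = (3 * eta - 2 * e) * l.
    by rewrite /a; field.
  by apply: ler_expRM => //; lra.
rewrite sumr_const card_ord -[leLHS]mulr_natl -expRM_natl -invn nE -expRD ler_expR.
have : 2 * l <= e * m%:R * l by rewrite ler_wpM2r.
lra.
Qed.

Lemma f_lower_exponent x : 0 < x < 1 / 2 \/ 1 / 2 < x < 1 ->
  exists k, [/\ (1 < k)%N, 1 < (1 - x) * k%:R, (1 - x) * k%:R <= 2 * (1 - f x)
              & f x <= 1 - x].
Proof.
rewrite /f => -[/andP[x0 x12]|/andP[x12 x1]].
  by exists 2%N; rewrite x12; split => //; lra.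
rewrite ltNge (ltW x12) /=.
have [x35|x35] := ltP x (3 / 5); first by exists 3%N; split => //; lra.
(* k = 3 needs 3(1-x) <= 2x and 1 < 3(1-x), that is, 3/5 <= x < 2/3. *)
have [x23|x23] := ltP x (2 / 3); first by exists 3%N; split => //; lra.
(* The least [k] with (1-x)k > 1. It satisfies (1-x)k <= 2 - x, which is at most 2x = 2(1 - f x)
   once x >= 2/3. *)
pose k := (Num.truncn (1 / (1 - x))).+1.
have x10 : 0 < 1 - x by rewrite subr_gt0.
have t0 : 0 <= 1 / (1 - x) by rewrite divr_ge0 // ltW.
have k1 : 1 < (1 - x) * k%:R.
  by rewrite mulrC -ltr_pdivrMr // truncnS_gt.
have k2 : (1 - x) * k%:R <= 1 + (1 - x).
  rewrite /k -natr1 mulrDr mulr1 lerD2r.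
  have : (Num.truncn (1 / (1 - x)))%:R <= 1 / (1 - x) by rewrite truncn_le.
  by rewrite ler_pdivlMr // mulrC.
exists k; split => //; last by lra.
rewrite -(ltr_nat R) -(ltr_pM2l x10); lra.
Qed.

Lemma likely_f x eps : 0 < x < 1 / 2 \/ 1 / 2 < x < 1 -> 0 < eps ->
  likely x (fun n G => expR ((f x - eps) * ln n%:R) <= (chi_c G)%:R) /\
  likely x (fun n G => (chi_c G)%:R <= expR ((f x + eps) * ln n%:R)).
Proof.
move=> hx eps0; have [x0 x1] : 0 < x /\ x < 1 by case: hx => /andP[]; lra.
split.
  have [k [k1 xk1 xk2 fx]] := f_lower_exponent hx.
  exact: (likely_lower k1).
(* The block and domination bounds require a small [eps]; a bound with a smaller error implies the
   one wanted. *)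
have weaken y e1 : 0 < e1 -> e1 <= eps ->
    likely x (fun n G => (chi_c G)%:R <= expR ((y + e1) * ln n%:R)) ->
    likely x (fun n G => (chi_c G)%:R <= expR ((y + eps) * ln n%:R)).
  move=> e10 e1eps [eta eta0 [l0 h]]; exists eta => //; exists l0 => n q n0 q01 ll qq.
  apply: le_trans (h n q n0 q01 ll qq); apply: le_prob => // G; apply: contra.
  move=> /le_trans; apply; apply: ler_expRM; first by rewrite ln_ge0 // ler1n.
  by rewrite lerD2l.
rewrite /f; case: hx => /andP[x0' x12].
  by rewrite x12; apply: likely_upper_degree.
rewrite ltNge (ltW x0') /=; have [x35|x35] := ltP x (3 / 5).
  have e0 : 0 < Num.min eps (1 - x) by rewrite lt_min eps0 subr_gt0.
  have e1 : Num.min eps (1 - x) <= 1 - x by rewrite ge_min lexx orbT.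
  apply: (weaken _ _ e0); first by rewrite ge_min lexx.
  by apply: likely_upper_blocks => //; lra.
have e0 : 0 < Num.min eps x by rewrite lt_min eps0.
apply: (weaken _ _ e0); first by rewrite ge_min lexx.
by apply: likely_upper_dominating => //; rewrite ge_min lexx orbT.
Qed.

(** Eventually p n = n^(x-1+eps n) with |eps n| within the window of [likely], and 3/n <= eta. *)
Lemma likely_near (p : nat -> R) x (A : forall n, pred (graph n)) eta :
    (forall n, 0 <= p n <= 1) -> eq_pow_o1 (fun n => p n * n%:R) x ->
    likely x A -> 0 < eta ->
  \forall n \near \oo%classic, prob (p n) (fun G => ~~ A n G) <= eta.
Proof.
move=> p01 [eps eps0 pE] [d d0 [l0 hA]] eta0.
near=> n.
have n0 : (0 < n)%N by near: n; exact: nbhs_infty_ge.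
have n0' : 0 < n%:R :> R by rewrite ltr0n.
have ln_l0 : l0 <= ln n%:R.
  rewrite -ler_expR -(lnK_nat n0).
  by near: n; exact: nbhs_infty_ger.
have ln0 : 0 <= ln n%:R :> R by rewrite ln_ge0 // ler1n.
have pn : p n * n%:R = n%:R `^ (x + eps n) by near: n.
have epsd : `|eps n| <= d.
  by near: n; move/cvgr0Pnorm_le : eps0; apply.
have pE' : p n = expR ((x - 1 + eps n) * ln n%:R).
  have : p n * n%:R = expR ((x + eps n) * ln n%:R).
    by rewrite pn /powR gt_eqF.
  have -> : (x + eps n) * ln n%:R = (x - 1 + eps n) * ln n%:R + ln n%:R by ring.
  by rewrite expRD -(lnK_nat n0) => /mulIf; apply; rewrite gt_eqF.
have /andP[e1 e2] : - d <= eps n <= d by rewrite -ler_norml.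
apply: (le_trans (hA n (p n) n0 (p01 n) ln_l0 _)).
  by rewrite pE'; apply/andP; split; apply: ler_expRM => //; lra.
rewrite ler_pdivrMr // mulrC -ler_pdivrMr //.
by near: n; exact: nbhs_infty_ger.
Unshelve. all: by end_near.
Qed.

(* Take [delta n = 1 / (j + 1)] for the largest [j <= n] with
   [1 - 1 / (j + 1) <= P n (1 / (j + 1))]; [j = 0] always qualifies. *)
Lemma diagonal_delta (P : nat -> R -> R) :
    (forall n e, 0 <= P n e <= 1) ->
    (forall e eta, 0 < e -> 0 < eta -> \forall n \near \oo%classic, 1 - eta <= P n e) ->
  exists2 delta : nat -> R, (delta n @[n --> \oo] --> (0 : R))%classic &
    (P n (delta n) @[n --> \oo] --> (1 : R))%classic.
Proof.
move=> P01 hP; pose d (j : nat) : R := j.+1%:R^-1.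
pose J n := \max_(j < n.+1 | 1 - d j <= P n (d j)) j.
have JP n : 1 - d (J n) <= P n (d (J n)).
  have [|j jA jE] := @eq_bigmax_cond 'I_n.+1 (fun j => 1 - d j <= P n (d j)) (fun j => j).
    apply/card_gt0P; exists ord0; change (1 - d 0%N <= P n (d 0%N)).
    by rewrite {1}/d invr1 subrr; case/andP: (P01 n (d 0%N)).
  by have -> : J n = j by exact: jE.
have dpos j : 0 < d j by rewrite invr_gt0.
have dJ eta : 0 < eta -> \forall n \near \oo%classic, d (J n) <= eta.
  move=> eta0; pose j := Num.truncn (eta^-1).
  have dj : d j <= eta.
    by rewrite /d -[leRHS]invrK lef_pV2 ?posrE ?invr_gt0 // ltW // truncnS_gt.
  (* For large [n] the fixed index [j] qualifies itself, so [J n] is at least [j]. *)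
  apply: (filterS2 _ _ (nbhs_infty_ge j) (hP _ _ (dpos j) (dpos j))) => n jn Pj.
  apply: le_trans dj; rewrite /d lef_pV2 ?posrE // ler_nat ltnS.
  by apply: (@leq_bigmax_cond _ _ (fun i : 'I_n.+1 => nat_of_ord i)
                              (Ordinal (jn : (j < n.+1)%N))).
exists (fun n => d (J n)).
  apply/cvgr0Pnorm_le => eta eta0; apply: (filterS _ (dJ eta eta0)) => n.
  by rewrite ger0_norm // ltW.
apply/cvgrPdist_le => eta eta0; apply: (filterS _ (dJ eta eta0)) => n dn.
have /andP[_ P1] := P01 n (d (J n)); have := JP n.
by rewrite ger0_norm ?subr_ge0 //; lra.
Qed.

End Asymptotics.

Theorem corollary1p2 (R : realType) (p : nat -> R) (x : R)
    (hp : forall n : nat, 0 <= p n <= 1)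
    (hx : 0 < x < 1 / 2 \/ 1 / 2 < x < 1)
    (hpn : eq_pow_o1 (fun n => p n * n%:R) x) :
  whp_chi_c_eq_pow_o1 p (f x).
Proof.
pose A e n (G : graph n) :=
  n%:R `^ (f x - e) <= (chi_c G)%:R <= n%:R `^ (f x + e).
(* It suffices to treat each fixed error [e]; the diagonal choice then lets the error tend to 0. *)
apply: (@diagonal_delta R (fun n e => gnp_prob (p n) (A e n))) => [n e|e eta e0 eta0].
  by rewrite gnp_probE prob_ge0 ?prob_le1.
have [hl hu] := likely_f hx e0.
have eta2 : 0 < eta / 2 by rewrite divr_gt0.
near=> n.
have n0 : (0 < n)%N by near: n; exact: nbhs_infty_ge.
have powE a : n%:R `^ a = expR (a * ln n%:R) :> R.
  by rewrite /powR gt_eqF // ltr0n.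
have h1 : prob (p n) (fun G : graph n =>
    ~~ (expR ((f x - e) * ln n%:R) <= (chi_c G)%:R)) <= eta / 2.
  by near: n; exact: (likely_near hp hpn hl eta2).
have h2 : prob (p n) (fun G : graph n =>
    ~~ ((chi_c G)%:R <= expR ((f x + e) * ln n%:R))) <= eta / 2.
  by near: n; exact: (likely_near hp hpn hu eta2).
rewrite gnp_probE lerBlDr -lerBlDl -probC.
have -> : eta = eta / 2 + eta / 2 by field.
apply: le_trans (lerD h1 h2); apply: le_trans (prob_or (hp n) _ _).
by apply: le_prob => // G; rewrite /A !powE negb_and.
Unshelve. all: by end_near.
Qed.
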